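(* Let $\mu\in\mathbb{R}$, $\sigma>0$ and $-\infty\le a<b\le+\infty$. Let $X_{\mathrm T}$ be the truncation to the interval $(a,b)$ of a normal random variable with mean $\mu$ and variance $\sigma^2$. Then the optimal variance proxy of $X_{\mathrm T}$ is $$\|X_{\mathrm T}\|_{\mathrm{vp}}^2=\sigma^2\times\begin{cases}1-\dfrac{2\sigma}{b+a-2\mu}\,\dfrac{\phi\left(\frac{a-\mu}{\sigma}\right)-\phi\left(\frac{b-\mu}{\sigma}\right)}{\Phi\left(\frac{b-\mu}{\sigma}\right)-\Phi\left(\frac{a-\mu}{\sigma}\right)} & \text{if } -\infty<a<b<+\infty \text{ and } a+b\neq 2\mu,\\[2ex] 1-\dfrac{2(b-\mu)}{\sigma}\,\dfrac{\phi\left(\frac{b-\mu}{\sigma}\right)}{2\Phi\left(\frac{b-\mu}{\sigma}\right)-1} & \text{if } -\infty<a<b<+\infty \text{ and } a+b=2\mu,\\[2ex] 1 & \text{if } a=-\infty \text{ and/or } b=+\infty.\end{cases}$$ In particular, $X_{\mathrm T}$ is strictly sub-Gaussian if and only if the truncation is symmetric relative to $\mu$, i.e. if and only if either $a,b$ are both finite and $a+b=2\mu$, or $a=-\infty$ and $b=+\infty$.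
   Context: $\phi$ and $\Phi$ denote the density and the cumulative distribution function of the standard normal distribution: $\phi(x)=\frac{1}{\sqrt{2\pi}}e^{-x^2/2}$, $\Phi(x)=\int_{-\infty}^x\phi(t)\,dt$. If $X$ has density $f_X$ and cumulative distribution function $F_X$, its truncation $X_{\mathrm T}$ to $(a,b)$ is a random variable with density $f_{X_{\mathrm T}}(x)=\frac{f_X(x)}{F_X(b)-F_X(a)}$ for $x\in(a,b)$ and $0$ otherwise (with $F_X(-\infty)=0$, $F_X(+\infty)=1$). A real random variable $X$ is sub-Gaussian if there is $s\ge 0$ such that $\mathbb{E}[\exp(\theta(X-\mathbb{E}[X]))]\le\exp\left(\frac{s^2\theta^2}{2}\right)$ for all $\theta\in\mathbb{R}$. Any such $s^2$ is called a variance proxy of $X$; the smallest such $s^2$ is the optimal variance proxy, denoted $\|X\|_{\mathrm{vp}}^2$. One says that $X$ is strictly sub-Gaussian if $\operatorname{Var}[X]=\|X\|_{\mathrm{vp}}^2$. *)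

(* Defs.v *)
From HB Require Import structures.
From mathcomp Require Import all_boot all_order all_algebra.
From mathcomp Require Import all_classical all_reals all_analysis.

Set Implicit Arguments.
Unset Strict Implicit.
Unset Printing Implicit Defensive.

Import Order.TTheory GRing.Theory Num.Theory.
Import numFieldNormedType.Exports.

Local Open Scope classical_set_scope.
Local Open Scope ring_scope.

Definition phi {R : realType} (x : R) : R := normal_pdf 0 1 x.

Lemma phiE {R : realType} (x : R) :
  phi x = (Num.sqrt (2 * pi))^-1 * expR (- (x ^+ 2) / 2).
Proof.
rewrite /phi normal_pdfE ?oner_neq0// /normal_peak /normal_fun.
by rewrite subr0 expr1n mul1r -(mulr_natl pi).
Qed.

Definition Phi {R : realType} (x : R) : R :=
  \int[lebesgue_measure]_(t in `]-oo, x]) phi t.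

Definition has_density {R : realType} {d : measure_display}
    {T : measurableType d} (P : probability T R) (X : {RV P >-> R})
    (f : R -> R) : Prop :=
  [/\ measurable_fun [set: R] f,
      forall x, 0 <= f x &
      forall A : set R, measurable A ->
        distribution P X A = (\int[lebesgue_measure]_(x in A) (f x)%:E)%E].

Definition normal_rv {R : realType} {d : measure_display}
    {T : measurableType d} (P : probability T R) (X : {RV P >-> R})
    (mu sigma : R) : Prop :=
  forall A : set R, measurable A ->
    distribution P X A = normal_prob mu sigma A.

Definition extended_cdf {R : realType} {d : measure_display}
    {T : measurableType d} (P : probability T R) (X : {RV P >-> R})
    (x : \bar R) : R :=
  match x with
  | EFin r => fine (cdf X r)
  | +oo%E => 1
  | -oo%E => 0
  end.

Definition truncated_pdf {R : realType} (f : R -> R) (F : \bar R -> R)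
    (a b : \bar R) (x : R) : R :=
  if (a < x%:E < b)%E then f x / (F b - F a) else 0.

(* The truncation is only determined in law, so [XT] may live on a probability
   space different from that of [X]. *)
Definition truncation {R : realType} {d d' : measure_display}
    {T : measurableType d} {T' : measurableType d'}
    (P : probability T R) (X : {RV P >-> R})
    (Q : probability T' R) (XT : {RV Q >-> R}) (a b : \bar R) : Prop :=
  exists2 f : R -> R, has_density X f &
    has_density XT (truncated_pdf f (extended_cdf X) a b).

(* [v] plays the role of s ^+ 2. Integrability is required explicitly because
   ['E_P[X]] is a total function whose value is meaningless otherwise. *)
Definition variance_proxy {R : realType} {d : measure_display}
    {T : measurableType d} (P : probability T R) (X : {RV P >-> R})
    (v : R) : Prop :=
  P.-integrable [set: T] (EFin \o X) /\
  exists s : R, [/\ 0 <= s, v = s ^+ 2 &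
    forall theta : R,
      ('E_P[fun w => expR (theta * (X w - fine 'E_P[X]))]
       <= (expR (s ^+ 2 * theta ^+ 2 / 2))%:E)%E].

Definition optimal_variance_proxy {R : realType} {d : measure_display}
    {T : measurableType d} (P : probability T R) (X : {RV P >-> R})
    (v : R) : Prop :=
  variance_proxy X v /\ forall w : R, variance_proxy X w -> v <= w.

Definition strictly_sub_gaussian {R : realType} {d : measure_display}
    {T : measurableType d} (P : probability T R) (X : {RV P >-> R}) : Prop :=
  exists2 v : R, optimal_variance_proxy X v & 'V_P[X] = v%:E.

(* Main.v *)
(* Standardize the truncated variable to Y on (al, be). Completing the square,
   E exp(t Y) = exp(t^2/2) G(t) / G(0) with G(t) = Phi(be - t) - Phi(al - t), so
   with m = E Y = G'(0) / G(0) a number v >= 0 is a variance proxy of Y iff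
   G(t) <= G(0) exp(t m - (1 - v) t^2 / 2) for all t.
   On a half-line, v = 1 works because Phi is log-concave (Mills' inequality),
   and nothing smaller does because G grows towards the infinite end.
   On a finite interval with midpoint c, G is even about c, so the condition at
   t = 2c forces v >= 1 - m / c. Conversely, ln G is a concave function of
   (t - c)^2, i.e. the ratio of -(ln G)' to t - c increases, and the tangent at
   (t - c)^2 = c^2 is exactly the required bound for v = 1 - m / c. For c = 0
   it gives v = Var Y, a lower bound for every proxy. The monotonicity being
   strict, Var Y < v when c <> 0, and Mills' inequality gives Var Y < 1 on a
   half-line. *)
Require Import Defs.
From HB Require Import structures.
From mathcomp Require Import all_boot all_order all_algebra.
From mathcomp Require Import ring lra.
From mathcomp Require Import all_classical all_reals all_analysis.
From mathcomp Require Import measurable_realfun.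

Import Order.TTheory GRing.Theory Num.Theory.
Import numFieldNormedType.Exports.

Set Implicit Arguments.
Unset Strict Implicit.
Unset Printing Implicit Defensive.

Local Open Scope classical_set_scope.
Local Open Scope ring_scope.

Lemma is_derive_congr (R : realType) (f g : R -> R) (x a b : R) :
  (forall y, f y = g y) -> a = b -> is_derive x 1 f a -> is_derive x 1 g b.
Proof. by move=> /funext -> ->. Qed.

Lemma is_derive_fun_cst (R : realType) (c x : R) : is_derive x 1 (fun=> c) 0.
Proof. exact: is_derive_cst. Qed.

Lemma is_derive_fun_id (R : realType) (x : R) : is_derive x 1 (fun y => y) 1.
Proof. exact: is_derive_id. Qed.

Lemma is_derive_funD (R : realType) (f g : R -> R) (x a b : R) :
  is_derive x 1 f a -> is_derive x 1 g b ->
  is_derive x 1 (fun y => f y + g y) (a + b).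
Proof. by move=> ? ?; apply: is_deriveD. Qed.

Lemma is_derive_funN (R : realType) (f : R -> R) (x a : R) :
  is_derive x 1 f a -> is_derive x 1 (fun y => - f y) (- a).
Proof. by move=> ?; apply: is_deriveN. Qed.

Lemma is_derive_funM (R : realType) (f g : R -> R) (x a b : R) :
  is_derive x 1 f a -> is_derive x 1 g b ->
  is_derive x 1 (fun y => f y * g y) (a * g x + f x * b).
Proof.
move=> ? ?; apply: (is_derive_congr (f := f * g)) (is_deriveM _ _) => //.
by rewrite addrC mulrC.
Qed.

Lemma is_derive_funX (R : realType) (f : R -> R) (n : nat) (x a : R) :
  is_derive x 1 f a ->
  is_derive x 1 (fun y => f y ^+ n) (n%:R * f x ^+ n.-1 * a).
Proof.
move=> ?; apply: (is_derive_congr _ _ (is_deriveX n _)) => // y.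
by rewrite fctE.
Qed.

Lemma is_derive_funV (R : realType) (f : R -> R) (x a : R) : f x != 0 ->
  is_derive x 1 f a -> is_derive x 1 (fun y => (f y)^-1) (- a / f x ^+ 2).
Proof.
move=> fx0 df; have := is_deriveV fx0 df; apply: is_derive_congr => //.
by rewrite /GRing.scale/=; field.
Qed.

Lemma is_derive_fun_comp (R : realType) (f g : R -> R) (x a b : R) :
  is_derive (g x) 1 f a -> is_derive x 1 g b ->
  is_derive x 1 (fun y => f (g y)) (a * b).
Proof. by move=> ? ?; apply: is_derive1_comp. Qed.

Lemma is_derive_fun_expR (R : realType) (f : R -> R) (x a : R) :
  is_derive x 1 f a -> is_derive x 1 (fun y => expR (f y)) (expR (f x) * a).
Proof. by move=> ?; apply: is_derive1_comp. Qed.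

Lemma is_derive_fun_ln (R : realType) (f : R -> R) (x a : R) : 0 < f x ->
  is_derive x 1 f a -> is_derive x 1 (fun y => ln (f y)) ((f x)^-1 * a).
Proof. by move=> fx0 ?; apply: is_derive1_comp; exact: is_derive1_ln. Qed.

(* Type class resolution would otherwise close the premises with the derivatives
   in the normal forms of the library instead of leaving them to [ring]. *)
Ltac derive_rec :=
  lazymatch goal with
  | |- is_derive ?x ?v ( *%R ?k) ?d =>
      change (is_derive x v (fun y => k * y) d); derive_rec
  | |- is_derive ?x ?v -%R ?d =>
      change (is_derive x v (fun y => - y) d); derive_rec
  | |- is_derive ?x ?v expR ?d =>
      change (is_derive x v (fun y => expR y) d); derive_rec
  | |- is_derive _ _ (fun y => y) _ =>
      notypeclasses refine (is_derive_fun_id _)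
  | |- is_derive _ _ (fun=> ?c) _ =>
      notypeclasses refine (is_derive_fun_cst _ _)
  | |- is_derive _ _ (fun y => _ + _) _ =>
      notypeclasses refine (is_derive_funD _ _); derive_rec
  | |- is_derive _ _ (fun y => - _) _ =>
      notypeclasses refine (is_derive_funN _); derive_rec
  | |- is_derive _ _ (fun y => _ * _) _ =>
      notypeclasses refine (is_derive_funM _ _); derive_rec
  | |- is_derive _ _ (fun y => _ ^+ _) _ =>
      notypeclasses refine (is_derive_funX _ _); derive_rec
  | |- is_derive _ _ (fun y => expR _) _ =>
      notypeclasses refine (is_derive_fun_expR _); derive_rec
  | |- _ => idtac
  end.

Ltac derive_tac :=
  notypeclasses refine (is_derive_congr (fun=> erefl) _ _); [|derive_rec].

Lemma mean_value (R : realType) (f df : R -> R) (a b : R) : a < b ->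
  (forall x, a <= x <= b -> is_derive x 1 f (df x)) ->
  exists2 c, a < c < b & f b - f a = df c * (b - a).
Proof.
move=> ab dfE; have [||c] := MVT (f := f) (df := df) ab.
- by move=> x; rewrite in_itv/= => /andP[? ?]; apply: dfE; rewrite !ltW.
- apply: derivable_within_continuous => x; rewrite in_itv/= => xab.
  by have := dfE _ xab.
- by rewrite in_itv/= => ? ?; exists c.
Qed.

Lemma derive_gt0_lt (R : realType) (f df : R -> R) (a b : R) : a < b ->
  (forall x, a <= x <= b -> is_derive x 1 f (df x)) ->
  (forall x, a < x < b -> 0 < df x) -> f a < f b.
Proof.
move=> ab dfE df0; have [c cab fE] := mean_value ab dfE.
by rewrite -subr_gt0 fE mulr_gt0 ?df0// subr_gt0.
Qed.

Lemma derive_ge0_le (R : realType) (f df : R -> R) (a b : R) : a <= b ->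
  (forall x, a <= x <= b -> is_derive x 1 f (df x)) ->
  (forall x, a < x < b -> 0 <= df x) -> f a <= f b.
Proof.
rewrite le_eqVlt => /predU1P[->//|ab] dfE df0.
have [c cab fE] := mean_value ab dfE.
by rewrite -subr_ge0 fE mulr_ge0 ?df0// subr_ge0 ltW.
Qed.

Lemma phi_gt0 (R : realType) (x : R) : 0 < phi x.
Proof.
rewrite phiE mulr_gt0 ?expR_gt0// invr_gt0 sqrtr_gt0.
by rewrite mulr_gt0// pi_gt0.
Qed.

Lemma is_derive_phi (R : realType) (x : R) : is_derive x 1 phi (- x * phi x).
Proof.
have d : is_derive x 1
    (fun y => (Num.sqrt (2 * pi))^-1 * expR (- (y ^+ 2) / 2))
    (- x * ((Num.sqrt (2 * pi))^-1 * expR (- (x ^+ 2) / 2))).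
  set c := (Num.sqrt _)^-1; derive_tac.
  by rewrite /=; field.
by apply: is_derive_congr d => [y|]; rewrite phiE.
Qed.

Lemma phiN (R : realType) (x : R) : phi (- x) = phi x.
Proof. by rewrite !phiE sqrrN. Qed.

Lemma is_derive_normal_cdf (R : realType) (m s x : R) : s != 0 ->
  is_derive x 1 (fun y => fine (normal_prob m s `]-oo, y]))
    (normal_pdf m s x).
Proof.
move=> s0.
have [||||d e] := @continuous_FTC1 R (normal_pdf m s) -oo%O x (x + 1) _ _ _.
- by rewrite ltrDl.
- apply: (integrableS _ _ (subsetT _)) => //.
  exact: integrable_normal_pdf.
- exact: ltNyr.
- by have := @continuous_normal_pdf R m s s0 x.
by apply: DeriveDef; [exact: d|rewrite -derive1E].
Qed.

Lemma is_derive_Phi (R : realType) (x : R) : is_derive x 1 Phi (phi x).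
Proof. exact: is_derive_normal_cdf (oner_neq0 R). Qed.

Definition normal_id (R : realType) : measurableTypeR R -> R := idfun.

HB.instance Definition _ (R : realType) :=
  @isMeasurableFun.Build _ _ _ _ (@normal_id R) (@measurable_id _ _ setT).

Lemma cvg_normal_cdfNy (R : realType) (m s : R) :
  fine (normal_prob m s `]-oo, x]) @[x --> -oo] --> (0 : R).
Proof.
by have /fine_cvg := @cvg_cdfNy0 _ _ R (normal_prob m s) (@normal_id R).
Qed.

Lemma cvg_PhiNy (R : realType) : Phi x @[x --> -oo] --> (0 : R).
Proof. exact: cvg_normal_cdfNy. Qed.

Lemma cvg_Phiy (R : realType) : Phi x @[x --> +oo] --> (1 : R).
Proof.
by have /fine_cvg := @cvg_cdfy1 _ _ R (normal_prob 0 1) (@normal_id R).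
Qed.

Lemma Phi_lt (R : realType) (x y : R) : x < y -> Phi x < Phi y.
Proof.
move=> xy; apply: (derive_gt0_lt xy) => z _; first exact: is_derive_Phi.
exact: phi_gt0.
Qed.

Lemma Phi_gt0 (R : realType) (x : R) : 0 < Phi x.
Proof.
apply: (@le_lt_trans _ _ (Phi (x - 1))); last by apply: Phi_lt; lra.
by rewrite fine_ge0// -/(normal_prob 0 1 _) measure_ge0.
Qed.

Lemma PhiN (R : realType) (x : R) : Phi (- x) = 1 - Phi x.
Proof.
pose F := fun y : R => Phi y + Phi (- y).
have FE y : F x = F y.
  apply: is_derive_0_is_cst => z.
  have dN : is_derive z 1 (fun y => Phi (- y)) (phi (- z) * - 1).
    by apply: is_derive_fun_comp (is_derive_Phi _) _.
  apply: (is_derive_congr (fun=> erefl) _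
    (is_derive_funD (is_derive_Phi z) dN)).
  by rewrite phiN; ring.
suff : F x = 1 by rewrite /F => <-; ring.
have : F y @[y --> +oo] --> (1 + 0 : R).
  apply: cvgD; first exact: cvg_Phiy.
  have := @cvg_PhiNy R; rewrite cvgNy_compNP; exact.
rewrite addr0 => F1.
have : F y @[y --> +oo] --> F x.
  under eq_fun do rewrite -FE. 
  exact: cvg_cst.
by move=> /(cvg_unique _); apply.
Qed.

Lemma normal_pdf_phi (R : realType) (m s x : R) : 0 < s ->
  normal_pdf m s x = phi ((x - m) / s) / s.
Proof.
move=> s0; have sn0 : s != 0 by rewrite gt_eqF.
rewrite phiE normal_pdfE// /normal_peak /normal_fun.
have -> : s ^+ 2 * pi *+ 2 = s ^+ 2 * (2 * pi) by ring.
rewrite sqrtrM ?sqr_ge0// sqrtr_sqr gtr0_norm// invfM.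
rewrite -mulrA mulrC; congr (_ * expR _ / _).
by rewrite -mulr_natl; field.
Qed.

Lemma normal_prob_Nyc (R : realType) (m s x : R) : 0 < s ->
  normal_prob m s `]-oo, x] = (Phi ((x - m) / s))%:E.
Proof.
move=> s0; have sn0 : s != 0 by rewrite gt_eqF.
rewrite -[LHS]fineK; last exact: (@fin_num_measure _ _ _ (normal_prob m s)).
congr EFin.
pose F := fun y : R => fine (normal_prob m s `]-oo, y]) - Phi ((y - m) / s).
have FE y : F x = F y.
  apply: is_derive_0_is_cst => z.
  have dZ : is_derive z 1 (fun y : R => Phi ((y - m) / s))
      (phi ((z - m) / s) * s^-1).
    apply: is_derive_fun_comp (is_derive_Phi _) _.
    by derive_tac; rewrite /=; field.
  apply: (is_derive_congr (fun=> erefl) _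
    (is_derive_funD (is_derive_normal_cdf m z sn0) (is_derive_funN dZ))).
  by rewrite normal_pdf_phi// subrr.
suff : F x = 0 by move/subr0_eq.
have F0 : F y @[y --> -oo] --> (0 - 0 : R).
  apply: cvgB; first exact: cvg_normal_cdfNy.
  have h : (fun y => (y - m) / s) y @[y --> -oo] --> -oo.
    apply: gt0_cvgMlNy; first by rewrite invr_gt0.
    exact: cvg_addrr_Ny.
  exact: (cvg_comp _ _ h (@cvg_PhiNy R)).
rewrite subr0 in F0.
have : F y @[y --> -oo] --> F x.
  by under eq_fun do rewrite -FE; exact: cvg_cst.
by move=> /(cvg_unique _); apply.
Qed.

Definition extended_normal_cdf (R : realType) (m s : R) (e : \bar R) : R :=
  match e with
  | r%:E => Phi ((r - m) / s)
  | +oo%E => 1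
  | -oo%E => 0
  end.

Lemma normal_prob_set1 (R : realType) (m s x : R) :
  normal_prob m s [set x] = 0%E.
Proof.
have /null_content_dominatesP := @normal_prob_dominates R m s; apply => //.
exact: lebesgue_measure_set1.
Qed.

Lemma normal_prob_Nyo (R : realType) (m s : R) (b : \bar R) : 0 < s ->
  normal_prob m s [set x | (x%:E < b)%E] = (extended_normal_cdf m s b)%:E.
Proof.
move=> s0; case: b => [r||] /=.
- rewrite -normal_prob_Nyc//.
  have -> : `]-oo, r]%classic = [set x | (x%:E < r%:E)%E] `|` [set r].
    apply/seteqP; split => x /=; rewrite in_itv/= lte_fin.
      by rewrite le_eqVlt => /predU1P[->|]; [right|left].
    by case=> [/ltW|->].
  rewrite measureU//; first by rewrite [X in (_ + X)%E]normal_prob_set1 adde0.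
    have -> : [set x | (x%:E < r%:E)%E] = `]-oo, r[%classic.
      by apply/seteqP; split => x /=; rewrite in_itv/= lte_fin.
    exact: measurable_itv.
  by apply/seteqP; split => x //= [] /[swap] ->; rewrite lte_fin ltxx.
- have -> : [set x : R | (x%:E < +oo)%E] = setT.
    by apply/seteqP; split => x //= _; rewrite ltry.
  exact: probability_setT.
- have -> : [set x : R | (x%:E < -oo)%E] = set0 by apply/seteqP; split.
  exact: measure0.
Qed.

Lemma measurable_preimage_EFin (R : realType) (i : interval (\bar R)) :
  measurable [set x : R | x%:E \in i].
Proof.
have := @EFin_measurable R setT measurableT _ (emeasurable_itv i).
by rewrite setTI.
Qed.

Lemma measurable_lt_ereal (R : realType) (b : \bar R) :
  measurable [set x : R | (x%:E < b)%E].
Proof.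
have := measurable_preimage_EFin `]-oo, b[.
by congr measurable; apply/seteqP; split => x /=; rewrite in_itv.
Qed.

Lemma measurable_ereal_oo (R : realType) (a b : \bar R) :
  measurable [set x : R | (a < x%:E < b)%E].
Proof.
have := measurable_preimage_EFin `]a, b[.
by congr measurable; apply/seteqP; split => x /=; rewrite in_itv.
Qed.

Lemma normal_prob_oo (R : realType) (m s : R) (a b : \bar R) : 0 < s ->
  (a < b)%E -> normal_prob m s [set x | (a < x%:E < b)%E] =
    (extended_normal_cdf m s b - extended_normal_cdf m s a)%:E.
Proof.
move=> s0 ab; rewrite EFinB -normal_prob_Nyo//.
case: a ab => [r||] /= ab.
- rewrite EFinN -normal_prob_Nyc//.
  have -> : [set x | (r%:E < x%:E < b)%E] =
      [set x | (x%:E < b)%E] `\` `]-oo, r].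
    apply/seteqP; split => x /=; rewrite in_itv/= lte_fin.
      by move=> /andP[rx xb]; split => //; apply/negP; rewrite -ltNge.
    by move=> [-> /negP]; rewrite -ltNge => ->.
  rewrite measureD//; last 2 first.
  - exact: measurable_lt_ereal.
  - by rewrite (le_lt_trans (probability_le1 _ _)) ?ltry//;
      exact: measurable_lt_ereal.
  congr (_ - normal_prob _ _ _)%E.
  apply/seteqP; split => x /=; rewrite in_itv/=; first by case.
  by move=> xr; split => //; rewrite (le_lt_trans _ ab)// lee_fin.
- by move: ab; rewrite ltNge leey.
- by rewrite oppr0 adde0; congr normal_prob; apply/seteqP; split => x /=;
    rewrite ltNyr.
Qed.

Lemma Phi_lt1 (R : realType) (x : R) : Phi x < 1.
Proof. by rewrite -subr_gt0 -PhiN Phi_gt0. Qed.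

Lemma extended_normal_cdf_lt (R : realType) (m s : R) (a b : \bar R) : 0 < s ->
  (a < b)%E -> extended_normal_cdf m s a < extended_normal_cdf m s b.
Proof.
move=> s0; case: a b => [a||] [b||]//=; rewrite ?lte_fin ?Phi_lt1 ?Phi_gt0//.
by move=> ab; apply: Phi_lt; rewrite ltr_pM2r ?invr_gt0// ltrD2r.
Qed.

Lemma ge0_integral_density d (T : measurableType d) (R : realType)
    (nu : {finite_measure set T -> \bar R})
    (mu : {sigma_finite_measure set T -> \bar R}) (g f : T -> \bar R) :
  measurable_fun setT g ->
  (forall A, measurable A -> nu A = \int[mu]_(x in A) g x)%E ->
  measurable_fun setT f -> (forall x, 0 <= f x)%E ->
  (\int[nu]_x f x = \int[mu]_x (f x * g x))%E.
Proof.
move=> mg nuE mf f0.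
have numu : nu `<< mu.
  apply/null_content_dominatesP => A mA muA; rewrite [LHS]nuE//.
  by apply: null_set_integral => //; exact: measurable_funTS.
rewrite -(Radon_Nikodym_SigmaFinite.change_of_variables numu)//.
apply: ae_eq_integral => //.
- apply: emeasurable_funM => //.
  exact: measurable_int (Radon_Nikodym_SigmaFinite.f_integrable numu).
- exact: emeasurable_funM.
apply: ae_eqe_mul2l; apply: integral_ae_eq => //.
- exact: Radon_Nikodym_SigmaFinite.f_integrable.
- move=> E _ mE.
  by rewrite -(Radon_Nikodym_SigmaFinite.f_integral numu)// nuE.
Qed.

Lemma extended_cdf_normal (R : realType) d (T : measurableType d)
    (P : probability T R) (X : {RV P >-> R}) (mu sigma : R) (e : \bar R) :
  0 < sigma -> normal_rv X mu sigma ->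
  extended_cdf X e = extended_normal_cdf mu sigma e.
Proof.
move=> s0 nX; case: e => [r||]//=.
by rewrite /cdf nX// normal_prob_Nyc.
Qed.

Lemma truncation_distribution (R : realType) (mu sigma : R) (a b : \bar R)
    (d d' : measure_display) (T : measurableType d) (T' : measurableType d')
    (P : probability T R) (X : {RV P >-> R})
    (Q : probability T' R) (XT : {RV Q >-> R}) : 0 < sigma ->
  (a < b)%E -> normal_rv X mu sigma -> truncation X XT a b ->
  forall A : set R, measurable A -> distribution Q XT A =
    (\int[lebesgue_measure]_(x in A)
       ((extended_normal_cdf mu sigma b - extended_normal_cdf mu sigma a)^-1 *
        (\1_[set x : R | (a < x%:E < b)%E] x * normal_pdf mu sigma x))%:E)%E.
Proof.
move=> s0 ab nX [f [mf f0 fE] [_ t0 tE]] A mA.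
set Z := _ - _; set S := [set x : R | _].
have mS : measurable S by exact: measurable_ereal_oo.
have S0 (g : R -> R) : (forall x, 0 <= g x) -> measurable_fun setT g ->
    (\int[lebesgue_measure]_(x in A) (Z^-1 * (\1_S x * g x))%:E =
    Z^-1%:E * \int[lebesgue_measure]_(x in A `&` S) (g x)%:E)%E.
  move=> g0 mg.
  have Z0 : 0 <= Z^-1.
    by rewrite invr_ge0 subr_ge0 ltW// extended_normal_cdf_lt.
  under eq_integral do rewrite EFinM.
  rewrite ge0_integralZl//; last 2 first.
  - exact/measurable_EFinP/measurable_funTS/measurable_funM.
  - by move=> x _; rewrite lee_fin mulr_ge0.
  congr (_ * _)%E; rewrite integral_mkcondr.
  apply: eq_integral => x _; rewrite patchE indicE.
  by case: ifPn => _; rewrite ?mul1r ?mul0r.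
rewrite tE//.
transitivity (\int[lebesgue_measure]_(x in A) (Z^-1 * (\1_S x * f x))%:E)%E.
  apply: eq_integral => x _; congr EFin.
  rewrite /truncated_pdf !(extended_cdf_normal _ s0 nX) -/Z indicE.
  case: ifPn => xS; first by rewrite mem_set// mul1r mulrC.
  by rewrite memNset ?mul0r ?mulr0//; exact/negP.
rewrite !S0//; last 2 first.
- exact: normal_pdf_ge0.
- exact: measurable_normal_pdf.
by rewrite -fE ?nX//; exact: measurableI.
Qed.

Lemma normal_pdf_tilt (R : realType) (mu sigma theta x : R) : 0 < sigma ->
  expR (theta * x) * normal_pdf mu sigma x =
  expR (theta * mu + sigma ^+ 2 * theta ^+ 2 / 2) *
    normal_pdf (mu + sigma ^+ 2 * theta) sigma x.
Proof.
move=> s0; have sn0 : sigma != 0 by rewrite gt_eqF.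
rewrite !normal_pdfE// /normal_fun !(mulrCA _ (normal_peak _)); congr (_ * _).
rewrite -!expRD; congr expR; field.
by rewrite sn0.
Qed.

(* The canonical measurable structure of [R] and that of [measurableTypeR R], on
   which the Lebesgue measure lives, have distinct displays although their
   measurable sets coincide. *)
Definition borel_rv (R : realType) d (T : measurableType d)
  (Q : probability T R) (Y : {RV Q >-> R}) : T -> measurableTypeR R := Y.

Lemma measurable_borel_rv (R : realType) d (T : measurableType d)
    (Q : probability T R) (Y : {RV Q >-> R}) :
  measurable_fun [set: T] (borel_rv Y).
Proof. exact: (measurable_funPT Y). Qed.

HB.instance Definition _ (R : realType) d (T : measurableType d)
    (Q : probability T R) (Y : {RV Q >-> R}) :=
  isMeasurableFun.Build _ _ _ _ (borel_rv Y) (measurable_borel_rv Y).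

Lemma expectation_expR_truncation (R : realType) (mu sigma : R) (a b : \bar R)
    (d d' : measure_display) (T : measurableType d) (T' : measurableType d')
    (P : probability T R) (X : {RV P >-> R})
    (Q : probability T' R) (XT : {RV Q >-> R}) (theta : R) : 0 < sigma ->
  (a < b)%E -> normal_rv X mu sigma -> truncation X XT a b ->
  let Z m := extended_normal_cdf m sigma b - extended_normal_cdf m sigma a in
  ('E_Q[fun w => expR (theta * XT w)] =
  (expR (theta * mu + sigma ^+ 2 * theta ^+ 2 / 2) *
    (Z (mu + sigma ^+ 2 * theta)%R / Z mu))%:E)%E.
Proof.
move=> s0 ab nX tX Z.
have mexp : measurable_fun [set: R] (fun x => expR (theta * x)).
  apply: measurableT_comp => //; exact: measurable_funM.
have Z0 : 0 <= (Z mu)^-1.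
  by rewrite invr_ge0 subr_ge0 ltW// extended_normal_cdf_lt.
set S := [set x : R | (a < x%:E < b)%E].
have mS : measurable S by exact: measurable_ereal_oo.
rewrite unlock.
transitivity (\int[distribution Q (borel_rv XT)]_x (expR (theta * x))%:E)%E.
  by rewrite ge0_integral_distribution//; exact/measurable_EFinP.
pose g (x : R) : R := (Z mu)^-1 * (\1_S x * normal_pdf mu sigma x).
rewrite (@ge0_integral_density _ (measurableTypeR R) R
  (distribution Q (borel_rv XT)) lebesgue_measure
  (EFin \o g))//; last 3 first.
- apply/measurable_EFinP/measurable_funM => //; apply: measurable_funM => //.
  exact: measurable_normal_pdf.
- exact: (truncation_distribution s0 ab nX tX).
- exact/measurable_EFinP.
set K := expR (_ + _).
transitivity (\int[lebesgue_measure]_x (((Z mu)^-1 * K)%:E *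
    (\1_S x * normal_pdf (mu + sigma ^+ 2 * theta) sigma x)%:E))%E.
  apply: eq_integral => x _; rewrite -!EFinM; congr EFin.
  rewrite mulrCA (mulrCA (expR _)) normal_pdf_tilt// -/K; ring.
rewrite ge0_integralZl//; last 3 first.
- apply/measurable_EFinP/measurable_funM => //.
  exact: measurable_normal_pdf.
- by move=> x _; rewrite lee_fin mulr_ge0// normal_pdf_ge0.
- by rewrite lee_fin mulr_ge0// expR_ge0.
transitivity (((Z mu)^-1 * K)%:E *
    normal_prob (mu + sigma ^+ 2 * theta) sigma S)%E.
  congr (_ * _)%E; rewrite /normal_prob [RHS]integral_mkcond.
  apply: eq_integral => x _; rewrite patchE indicE.
  by case: ifPn => _; rewrite ?mul1r ?mul0r.
by rewrite normal_prob_oo// -EFinM /Z; congr EFin; ring.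
Qed.

Definition sinh (R : realType) (x : R) : R := (expR x - expR (- x)) / 2.
Definition cosh (R : realType) (x : R) : R := (expR x + expR (- x)) / 2.

Lemma sinh0 (R : realType) : sinh 0 = 0 :> R.
Proof. by rewrite /sinh oppr0 subrr mul0r. Qed.

Lemma cosh0 (R : realType) : cosh 0 = 1 :> R.
Proof. by rewrite /cosh oppr0 expR0; field. Qed.

Lemma coshN (R : realType) (x : R) : cosh (- x) = cosh x.
Proof. by rewrite /cosh opprK addrC. Qed.

Lemma is_derive_sinh (R : realType) (x : R) : is_derive x 1 (@sinh R) (cosh x).
Proof. by rewrite /sinh /cosh; derive_tac; rewrite /=; field. Qed.

Lemma is_derive_cosh (R : realType) (x : R) : is_derive x 1 (@cosh R) (sinh x).
Proof. by rewrite /sinh /cosh; derive_tac; rewrite /=; field. Qed.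

Lemma sqr_cosh (R : realType) (x : R) : cosh x ^+ 2 = 1 + sinh x ^+ 2.
Proof.
have := expRN x; have := expR_gt0 x; rewrite /cosh /sinh.
by move: (expR x) => e e0 ->; field; rewrite gt_eqF.
Qed.

Lemma cosh_double (R : realType) (x : R) :
  cosh (2 * x) = 1 + 2 * sinh x ^+ 2.
Proof.
have := expRN x; have := expR_gt0 x; rewrite /cosh /sinh.
rewrite -mulrN !expRM_natl.
by move: (expR x) => e e0 ->; field; rewrite gt_eqF.
Qed.

Lemma cosh_ge1 (R : realType) (x : R) : 1 <= cosh x.
Proof.
have := sqr_ge0 (sinh x); have := sqr_cosh x.
have : 0 < cosh x by rewrite /cosh divr_gt0// addr_gt0// expR_gt0.
by move=> *; nra.
Qed.

Lemma sinh_ge (R : realType) (x : R) : 0 <= x -> x <= sinh x.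
Proof.
move=> x0; rewrite -subr_ge0.
have -> : 0 = sinh 0 - 0 :> R by rewrite sinh0 subr0.
apply: (@derive_ge0_le _ (fun y => sinh y - y) (fun y => cosh y - 1)) => //.
  move=> y _; have ? := is_derive_sinh y.
  by apply: is_derive_funD => //; apply: is_derive_funN;
    apply: is_derive_fun_id.
by move=> y _; rewrite subr_ge0 cosh_ge1.
Qed.

Lemma sinh_gt0 (R : realType) (x : R) : 0 < x -> 0 < sinh x.
Proof. by move=> x0; rewrite (lt_le_trans x0)// sinh_ge// ltW. Qed.

Lemma tanh_lt (R : realType) (x : R) : 0 < x -> sinh x < x * cosh x.
Proof.
move=> x0; rewrite -subr_gt0.
have -> : 0 = 0 * cosh 0 - sinh 0 :> R by rewrite sinh0 mul0r subr0.
apply: (@derive_gt0_lt _ (fun y => y * cosh y - sinh y)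
  (fun y => y * sinh y)) => //.
  move=> y _; have ? := is_derive_sinh y; have ? := is_derive_cosh y.
  apply: (is_derive_congr (fun=> erefl) _ (is_derive_funD
    (is_derive_funM (is_derive_fun_id y) (is_derive_cosh y))
    (is_derive_funN (is_derive_sinh y)))).
  by ring.
by move=> y /andP[y0 _]; rewrite mulr_gt0// sinh_gt0.
Qed.

Lemma lt_sinh_cosh (R : realType) (x : R) : 0 < x -> x < sinh x * cosh x.
Proof.
move=> x0; have /= h := sinh_ge (ltW x0); have := tanh_lt x0.
have := sqr_cosh x; have := cosh_ge1 x; have := sinh_gt0 x0.
move: (sinh x) (cosh x) h => s c; nra.
Qed.

Lemma sqr_le_cosh (R : realType) (x : R) : x ^+ 2 <= 2 * cosh x - 2.
Proof.
have -> : cosh x = cosh (2 * (x / 2)) by congr cosh; field.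
rewrite cosh_double.
wlog x0 : x / 0 <= x => [h|].
  have [/h//|/ltW x0] := leP 0 x.
  have := h (- x); rewrite oppr_ge0 sqrrN => /(_ x0).
  by rewrite mulNr /sinh opprK; lra.
have : 0 <= x / 2 by rewrite divr_ge0.
by move/[dup]/sinh_ge; move: (sinh _) => s; nra.
Qed.

(* With [u = cosh x - 1] the left-hand side is [2 u - u ^ 2], which agrees with
   [x ^ 2] up to an error of order 4 and is a combination of exponentials: it bounds second
   moments from below in terms of moment generating functions. *)
Lemma cosh_le_sqr (R : realType) (x : R) :
  4 * cosh x - cosh (2 * x) / 2 - 7 / 2 <= x ^+ 2.
Proof.
wlog x0 : x / 0 < x => [h|].
  have [/h//|x0|<-] := ltgtP 0 x; last by rewrite mulr0 cosh0; lra.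
  by have := h (- x); rewrite oppr_gt0 mulrN !coshN sqrrN => /(_ x0).
set z := x / 2; have xE : x = 2 * z by rewrite /z; field.
have z0 : 0 < z by rewrite divr_gt0.
have := tanh_lt z0; have := sinh_gt0 z0; have := sqr_cosh z.
rewrite cosh_double xE cosh_double.
have -> : sinh (2 * z) ^+ 2 = 4 * sinh z ^+ 2 * cosh z ^+ 2.
  by have := cosh_double (2 * z); have := sqr_cosh (2 * z); rewrite cosh_double;
    have := sqr_cosh z; nra.
move: (sinh z) (cosh z) => s c c2 s0 szc.
have h : s ^+ 2 <= z ^+ 2 * c ^+ 2.
  by rewrite -exprMn ler_sqr ?nnegrE ?ltW// (lt_trans s0).
have : s ^+ 2 * (1 - s ^+ 2) <= z ^+ 2.
  have c0 : 0 < 1 + s ^+ 2 by rewrite ltr_pwDl// sqr_ge0.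
  rewrite -(ler_pM2r c0); have := sqr_ge0 (s ^+ 3).
  by rewrite c2 in h; nra.
by rewrite c2; nra.
Qed.

Definition has_mgf (R : realType) d (T : measurableType d)
    (Q : probability T R) (W : T -> R) (M : R -> R) : Prop :=
  measurable_fun [set: T] W /\
  (forall theta, 'E_Q[fun w => expR (theta * W w)%R] = (M theta)%:E)%E.

Lemma has_mgf_affine (R : realType) d (T : measurableType d)
    (Q : probability T R) (W : T -> R) (M : R -> R) (m s : R) :
  has_mgf Q W M ->
  has_mgf Q (fun w => s * (W w - m))
    (fun theta => expR (- (s * theta * m)) * M (s * theta)).
Proof.
move=> [mW MW]; split.
  by apply: measurable_funM => //; exact: measurable_funB.
move=> theta; have := MW (s * theta); rewrite unlock => MWt.
transitivity (\int[Q]_w ((expR (- (s * theta * m)))%:E *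
    (expR (s * theta * W w))%:E))%E.
  apply: eq_integral => w _; rewrite -EFinM -expRD; congr (expR _)%:E; ring.
rewrite ge0_integralZl//; first by rewrite MWt.
apply/measurable_EFinP; apply: measurableT_comp => //.
exact: measurable_funM.
Qed.

Lemma Rintegral_probability_cst (R : realType) d (T : measurableType d)
  (Q : probability T R) (c : R) : \int[Q]_w c = c.
Proof. by have := expectation_cst Q c; rewrite unlock /Rintegral => ->. Qed.

Section mgf.
Context (R : realType) d (T : measurableType d) (Q : probability T R).
Context (W : T -> R) (M : R -> R) (MW : has_mgf Q W M).

Lemma mgf_measurable_exp (theta : R) :
  measurable_fun [set: T] (fun w => expR (theta * W w)).
Proof.
case: MW => mW _.
by apply: measurableT_comp => //; exact: measurable_funM.
Qed.

Lemma mgf_integrable (theta : R) :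
  Q.-integrable [set: T] (EFin \o (fun w => expR (theta * W w))).
Proof.
apply/integrableP; split; first exact/measurable_EFinP/mgf_measurable_exp.
under eq_integral do rewrite /= ger0_norm ?expR_ge0//.
by have := MW.2 theta; rewrite unlock => ->; rewrite ltry.
Qed.

Lemma mgf_Rintegral (theta : R) : \int[Q]_w expR (theta * W w) = M theta.
Proof. by have := MW.2 theta; rewrite unlock /Rintegral => ->. Qed.

Lemma mgf0 : M 0 = 1.
Proof.
rewrite -mgf_Rintegral; under eq_Rintegral do rewrite mul0r expR0.
exact: Rintegral_probability_cst.
Qed.

Lemma integrable_cosh (theta : R) :
  Q.-integrable [set: T] (EFin \o (fun w => cosh (theta * W w))).
Proof.
have := integrableZl measurableT 2^-1 (integrableD measurableT
  (mgf_integrable theta) (mgf_integrable (- theta))).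
apply: eq_integrable => // w _ /=.
by rewrite -EFinD -EFinM /cosh mulNr; congr EFin; field.
Qed.

Lemma Rintegral_cosh (theta : R) :
  \int[Q]_w cosh (theta * W w) = (M theta + M (- theta)) / 2.
Proof.
rewrite -!mgf_Rintegral -RintegralD//; try exact: mgf_integrable.
rewrite mulrC -RintegralZl//; last first.
  exact: (integrableD _ (mgf_integrable _) (mgf_integrable _)).
by apply: eq_Rintegral => w _; rewrite /cosh mulNr mulrC.
Qed.

Lemma integrable_sqr :
  Q.-integrable [set: T] (EFin \o (fun w => W w ^+ 2)).
Proof.
have [mW _] := MW.
apply: (le_integrable measurableT _ _ (integrableZl measurableT 2
  (integrable_cosh 1))).
  by apply/measurable_EFinP; exact: measurable_funX.
move=> w _ /=; rewrite mul1r lee_fin ger0_norm ?sqr_ge0//.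
have := sqr_le_cosh (W w); have := cosh_ge1 (W w).
by move=> *; rewrite ger0_norm; lra.
Qed.

Lemma integrable_id : Q.-integrable [set: T] (EFin \o W).
Proof.
have [mW _] := MW.
apply: (le_integrable measurableT _ _ (integrableZl measurableT 2
  (integrable_cosh 1))).
  exact/measurable_EFinP.
move=> w _ /=; rewrite mul1r lee_fin.
have := sqr_le_cosh (W w); have := cosh_ge1 (W w).
move=> *; rewrite [leRHS]ger0_norm; last by lra.
by rewrite ler_norml; apply/andP; split; nra.
Qed.

Lemma mgf_mean (m : R) :
  (forall x : R, derivable M x 1) -> is_derive (0 : R) 1 M m ->
  \int[Q]_w W w = m.
Proof.
move=> dM M0; set I := \int[Q]_w W w.
have MI theta : 1 + theta * I <= M theta.
  rewrite -mgf_Rintegral /I -RintegralZl//; last exact: integrable_id.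
  have <- : \int[Q]_w (1 : R) = 1.
    exact: Rintegral_probability_cst.
  have iW : Q.-integrable [set: T] (EFin \o (fun w => theta * W w)).
    exact: (integrableZl measurableT theta integrable_id).
  have i1 : Q.-integrable [set: T] (EFin \o (fun=> 1)).
    exact: finite_measure_integrable_cst.
  rewrite -RintegralD//; apply: le_Rintegral => //.
  - exact: (integrableD measurableT i1 iW).
  - exact: mgf_integrable.
  - by move=> w _; exact: expR_ge1Dx.
have dF x : derivable (fun t => M t - t * I) x 1.
  by apply: derivableB => //; apply: derivableM.
have [|||_ F0] := @derive1_at_min _ (fun t => M t - t * I) (-1) 1 0 _
  (fun t _ => dF t).
- by lra.
- by rewrite in_itv/=; lra.
- by move=> t _; rewrite mul0r subr0 mgf0; have := MI t; lra.
have : is_derive (0 : R) 1 (fun t => M t - t * I) (m - I).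
  apply: (is_derive_congr (fun=> erefl) _ (is_derive_funD M0
    (is_derive_funN (is_derive_funM (is_derive_fun_id 0)
      (is_derive_fun_cst I _))))).
  by ring.
by move=> [_]; rewrite F0 => /esym/subr0_eq.
Qed.

Lemma mgf_sqr_ub (theta : R) :
  theta ^+ 2 * \int[Q]_w W w ^+ 2 <= M theta + M (- theta) - 2.
Proof.
have ic := integrableZl measurableT 2 (integrable_cosh theta).
have i2 : Q.-integrable [set: T] (EFin \o (fun=> 2)).
  exact: finite_measure_integrable_cst.
have -> : M theta + M (- theta) - 2 = \int[Q]_w (2 * cosh (theta * W w) - 2).
  rewrite RintegralB// RintegralZl//; last exact: integrable_cosh.
  by rewrite Rintegral_probability_cst Rintegral_cosh /=; field.
rewrite -RintegralZl//; last exact: integrable_sqr.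
apply: le_Rintegral => //.
- exact: (integrableZl measurableT _ integrable_sqr).
- exact: (integrableB measurableT ic i2).
- by move=> w _; rewrite -exprMn; exact: sqr_le_cosh.
Qed.

Lemma mgf_sqr_lb (theta : R) :
  2 * (M theta + M (- theta)) - (M (2 * theta) + M (- (2 * theta))) / 4 - 7 / 2
  <= theta ^+ 2 * \int[Q]_w W w ^+ 2.
Proof.
rewrite -RintegralZl//; last exact: integrable_sqr.
have i4 := integrableZl measurableT 4 (integrable_cosh theta).
have i2 := integrableZl measurableT 2^-1 (integrable_cosh (2 * theta)).
have i42 := integrableB measurableT i4 i2.
have i7 : Q.-integrable [set: T] (EFin \o (fun=> 7 / 2)).
  exact: finite_measure_integrable_cst.
have -> : 2 * (M theta + M (- theta)) -
    (M (2 * theta) + M (- (2 * theta))) / 4 - 7 / 2 =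
    \int[Q]_w (4 * cosh (theta * W w) - 2^-1 * cosh (2 * theta * W w) - 7 / 2).
  rewrite RintegralB// RintegralB//.
  rewrite (RintegralZl 4 measurableT (integrable_cosh theta)).
  rewrite (RintegralZl 2^-1 measurableT (integrable_cosh (2 * theta))).
  by rewrite Rintegral_probability_cst !Rintegral_cosh /=; field.
apply: le_Rintegral => //.
- exact: (integrableB measurableT i42 i7).
- exact: (integrableZl measurableT _ integrable_sqr).
- move=> w _; rewrite -exprMn -mulrA.
  by have := cosh_le_sqr (theta * W w); lra.
Qed.

End mgf.

Lemma is_derive_eps (R : realType) (f : R -> R) (x a e : R) : 0 < e ->
  is_derive x 1 f a ->
  exists2 r : R, 0 < r & forall h : R, `|h| < r ->
    `|f (x + h) - f x - a * h| <= e * `|h|.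
Proof.
move=> e0 [+ <-] => /cvgrPdist_le /(_ _ e0).
rewrite /dnbhs near_withinE => /nbhs_ballP[r /= r0 H].
exists r => // h hr; have [->|h0] := eqVneq h 0.
  by rewrite addr0 mulr0 !subrr normr0 mulr0.
have := H h; rewrite /ball/= sub0r normrN => /(_ hr h0).
have h1 : 0 < `|h| by rewrite normr_gt0.
rewrite -(ler_pM2r h1) -normrM; apply: le_trans; rewrite -normrN.
rewrite le_eqVlt; apply/orP; left; apply/eqP; congr `|_|.
rewrite /derive /GRing.scale/= mulr1 (addrC h x).
by field.
Qed.

Lemma second_order_expansion (R : realType) (C C1 : R -> R) (q e : R) : 0 < e ->
  C 0 = 1 -> C1 0 = 0 -> (forall x : R, is_derive x 1 C (C1 x)) ->
  is_derive (0 : R) 1 C1 q ->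
  exists2 r : R, 0 < r & forall t, 0 < t < r ->
    `|C t - 1 - q * t ^+ 2 / 2| <= e * t ^+ 2.
Proof.
move=> e0 C0 C10 dC dC1; have [r r0 Hr] := is_derive_eps e0 dC1.
exists r => // t /andP[t0 tr].
have [|c /andP[c0 ct]] := @mean_value _ (fun x => C x - q * x ^+ 2 / 2)
    (fun x => C1 x - q * x) 0 t t0.
  move=> x _; apply: is_derive_funD.
  by derive_tac; rewrite /=; field.
rewrite C0 expr0n/= mulr0 mul0r !subr0 => CE.
have -> : C t - 1 - q * t ^+ 2 / 2 = C t - q * t ^+ 2 / 2 - 1 by ring.
have cr : `|c| < r by rewrite gtr0_norm// (lt_trans ct).
have := Hr c cr; rewrite add0r C10 subr0 CE (gtr0_norm c0) => H.
rewrite normrM (gtr0_norm t0) expr2 mulrA ler_pM2r//.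
by rewrite (le_trans H)// ler_pM2l// ltW.
Qed.

Lemma mgf_second_moment (R : realType) d (T : measurableType d)
    (Q : probability T R) (W : T -> R) (M M1 : R -> R) (q : R) :
  has_mgf Q W M -> (forall x : R, is_derive x 1 M (M1 x)) ->
  is_derive (0 : R) 1 M1 q -> \int[Q]_w W w ^+ 2 = q.
Proof.
move=> MW dM dM1; set V := \int[Q]_w _.
pose C t := (M t + M (- t)) / 2; pose C1 t := (M1 t - M1 (- t)) / 2.
have dN (x : R) : is_derive x 1 (fun t : R => - t) (- 1).
  exact: is_derive_funN (is_derive_fun_id _).
have dC (x : R) : is_derive x 1 C (C1 x).
  apply: (is_derive_congr (fun=> erefl) _ (is_derive_funM (is_derive_funD (dM x)
    (is_derive_fun_comp (dM (- x)) (dN x))) (is_derive_fun_cst 2^-1 _))).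
  by rewrite /C1; ring.
have dC1 : is_derive (0 : R) 1 C1 q.
  have dM1' : is_derive (- 0 : R) 1 M1 q by rewrite oppr0.
  apply: (is_derive_congr (fun=> erefl) _ (is_derive_funM (is_derive_funD dM1
    (is_derive_funN (is_derive_fun_comp dM1' (dN 0))))
    (is_derive_fun_cst 2^-1 _))).
  by field.
have C0 : C 0 = 1 by rewrite /C oppr0 (mgf0 MW); field.
have C10 : C1 0 = 0 by rewrite /C1 oppr0 subrr mul0r.
have ub t : t ^+ 2 * V <= 2 * (C t - 1).
  by have := mgf_sqr_ub MW t; rewrite -/V /C; lra.
have lb t : 4 * C t - C (2 * t) / 2 - 7 / 2 <= t ^+ 2 * V.
  by have := mgf_sqr_lb MW t; rewrite -/V /C; lra.
have close e : 0 < e -> `|V - q| <= e.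
  move=> e0; have e6 : 0 < e / 6 by rewrite divr_gt0.
  have [r r0 H] := second_order_expansion e6 C0 C10 dC dC1.
  pose t := r / 3; have t0 : 0 < t by rewrite divr_gt0.
  have /H : 0 < t < r by rewrite t0/= /t; lra.
  have /H : 0 < 2 * t < r by rewrite /t; apply/andP; split; lra.
  rewrite !ler_distl => /andP[h1 h2] /andP[h3 h4].
  have t2 : 0 < t ^+ 2 by rewrite exprn_gt0.
  have := ub t; have := lb t; rewrite exprMn in h1 h2.
  rewrite -![t ^+ 2 * V]mulrC => h5 h6.
  apply/andP; split; rewrite -(ler_pM2r t2); nra.
apply/eqP; rewrite -subr_eq0 -normr_le0; apply/ler_addgt0Pl => e e0.
by rewrite addr0 close.
Qed.

Lemma mgf_variance_proxy_ge (R : realType) d (T : measurableType d)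
    (Q : probability T R) (W : T -> R) (M : R -> R) (v : R) :
  has_mgf Q W M -> (forall t, M t <= expR (v * t ^+ 2 / 2)) ->
  \int[Q]_w W w ^+ 2 <= v.
Proof.
move=> MW Mv; set V := \int[Q]_w _.
rewrite leNgt; apply/negP => vV.
have ubu u : 0 < u -> v * u < 1 -> (1 + u * V) * (1 - v * u) <= 1.
  move=> u0 vu1; pose t := Num.sqrt (2 * u).
  have t2 : t ^+ 2 = 2 * u by rewrite sqr_sqrtr// mulr_ge0// ltW.
  have := mgf_sqr_ub MW t; have := Mv t; have := Mv (- t).
  rewrite sqrrN t2 (_ : v * _ / 2 = v * u); last by field.
  move=> h1 h2 h3; have h : 1 + u * V <= expR (v * u).
    by rewrite -/V in h3; lra.
  have p : 0 < 1 - v * u by rewrite subr_gt0.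
  have := expR_ge1Dx (- (v * u)); rewrite expRN => h4.
  rewrite -ler_pdivlMr// (le_trans h)// mul1r -[leLHS]invrK lef_pV2//.
  by rewrite posrE invr_gt0 expR_gt0.
pose D := V - v; have D0 : 0 < D by rewrite subr_gt0.
pose K := 1 + `|v| + `|v * V| / D.
have vVD : 0 <= `|v * V| / D by rewrite divr_ge0// ltW.
have vn : 0 <= `|v| by [].
have K0 : 0 < K by rewrite /K; lra.
have u0 : 0 < K^-1 by rewrite invr_gt0.
have vu1 : v * K^-1 < 1.
  by rewrite ltr_pdivrMr// mul1r (le_lt_trans (ler_norm v))// /K; lra.
have := ubu _ u0 vu1; set u := K^-1 => h.
have DvV : D <= u * (v * V).
  by rewrite -(ler_pM2l u0) -/u /D; lra.
have : D < D; last by rewrite ltxx.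
rewrite {1}(le_lt_trans DvV)// (@le_lt_trans _ _ (u * `|v * V|))//.
  by rewrite ler_pM2l// ler_norm.
have vVK : `|v * V| < K * D by rewrite -ltr_pdivrMr// /K; lra.
by rewrite /u mulrC ltr_pdivrMr// (mulrC D).
Qed.

Lemma is_derive_dist_lt (R : realType) (f : R -> R) (x a e : R) : 0 < e ->
  is_derive x 1 f a ->
  exists2 r : R, 0 < r & forall h : R, `|h| < r -> `|f (x + h) - f x| < e.
Proof.
move=> e0 df; have [r r0 Hr] := is_derive_eps ltr01 df.
have a1 : 0 < `|a| + 1 by rewrite ltr_wpDl.
exists (Num.min r (e / (`|a| + 1))) => [|h].
  by rewrite lt_min r0 divr_gt0.
rewrite lt_min => /andP[/Hr h1]; rewrite ltr_pdivlMr// => h2.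
have -> : f (x + h) - f x = (f (x + h) - f x - a * h) + a * h by ring.
rewrite (le_lt_trans (ler_normD _ _))// normrM; nra.
Qed.

Lemma Mills_inequality (R : realType) (x : R) : 0 < x * Phi x + phi x.
Proof.
have [x0|x0] := leP 0 x.
  by rewrite ltr_wpDl ?phi_gt0// mulr_ge0// ltW// Phi_gt0.
pose F (y : R) : R := - phi y / y - Phi y.
have Flt (y z : R) : y < z -> z < 0 -> F y < F z.
  move=> yz z0; apply: (@derive_gt0_lt _ F (fun w => phi w / w ^+ 2)) => //.
    move=> w /andP[_ wz]; have w0 : w != 0 by rewrite lt_eqF// (le_lt_trans wz).
    have dV : is_derive w 1 (fun y : R => y^-1) (- 1 / w ^+ 2).
      exact: is_derive_funV (is_derive_fun_id _).
    apply: (is_derive_congr (fun=> erefl) _ (is_derive_funD (is_derive_funM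
      (is_derive_funN (is_derive_phi w)) dV)
      (is_derive_funN (is_derive_Phi w)))).
    by field.
  move=> w /andP[_ wz]; rewrite divr_gt0 ?phi_gt0//.
  by rewrite exprn_even_gt0//= lt_eqF// (lt_trans wz).
suff : 0 < F x.
  rewrite /F -(ltr_nM2r x0) mul0r mulrBl mulrVK ?unitfE ?lt_eqF//; lra.
apply: (@le_lt_trans _ _ (F (x - 1))); last by apply: Flt => //; lra.
rewrite leNgt; apply/negP => F0; pose e := - F (x - 1).
have e0 : 0 < e by rewrite oppr_gt0.
have [y yx Phiy] : exists2 y, y < x - 1 & Phi y < e.
  near (ninfty_nbhs R) => y; exists y; near: y.
    by apply: nbhs_ninfty_lt; rewrite num_real.
  exact: (cvgr_lt _ (@cvg_PhiNy R)).
have := Flt _ _ yx; have Fy : - Phi y < F y.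
  rewrite /F ltrDr mulNr -mulrN -invrN mulr_gt0 ?phi_gt0//.
  by rewrite invr_gt0 oppr_gt0; lra.
have x1 : x - 1 < 0 by lra.
by move=> /(_ x1); rewrite /e in Phiy; lra.
Unshelve. all: by end_near. Qed.

Lemma derive_sign_max (R : realType) (f df : R -> R) (c x : R) :
  (forall y : R, is_derive y 1 f (df y)) ->
  (forall y, x < y < c -> 0 <= df y) -> (forall y, c < y < x -> df y <= 0) ->
  f x <= f c.
Proof.
move=> dF up down; have [xc|cx] := leP x c.
  by apply: (derive_ge0_le xc).
rewrite -lerN2; apply: (@derive_ge0_le _ (fun y => - f y) (fun y => - df y)).
- exact: ltW.
- by move=> y yc; rewrite oppr_ge0 down.
Qed.

Definition hazard (R : realType) (x : R) : R := phi x / Phi x.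

Lemma is_derive_hazard (R : realType) (x : R) : is_derive x 1 (@hazard R)
  (- (phi x * (x * Phi x + phi x)) / Phi x ^+ 2).
Proof.
have P0 : Phi x != 0 by rewrite gt_eqF// Phi_gt0.
apply: (is_derive_congr (fun=> erefl) _ (is_derive_funM (is_derive_phi x)
  (is_derive_funV P0 (is_derive_Phi x)))).
by field.
Qed.

Lemma hazard_lt (R : realType) (x y : R) : x < y -> hazard y < hazard x.
Proof.
move=> xy; rewrite -ltrN2.
apply: (@derive_gt0_lt _ (fun z => - hazard z) (fun z => -
  (- (phi z * (z * Phi z + phi z)) / Phi z ^+ 2))) => //.
  by move=> z _; apply: is_derive_funN; apply: is_derive_hazard.
move=> z _; rewrite mulNr opprK divr_gt0//.
  by rewrite mulr_gt0 ?phi_gt0 ?Mills_inequality.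
by rewrite exprn_gt0 ?Phi_gt0.
Qed.

Lemma Phi_log_concave (R : realType) (y t : R) :
  Phi (y + t) <= Phi y * expR (t * hazard y).
Proof.
pose f (t : R) : R := ln (Phi (y + t)) - t * hazard y.
have dPhi (s : R) : is_derive s 1 (fun t : R => Phi (y + t)) (phi (y + s)).
  apply: (is_derive_congr (fun=> erefl) _ (is_derive_fun_comp
    (is_derive_Phi (y + s)) (is_derive_funD (is_derive_fun_cst y _)
    (is_derive_fun_id _)))).
  by ring.
have : f t <= f 0.
  apply: (@derive_sign_max _ f (fun s => hazard (y + s) - hazard y)).
  - move=> s; apply: (is_derive_congr (fun=> erefl) _ (is_derive_funD
      (is_derive_fun_ln (f := fun t => Phi (y + t)) (Phi_gt0 _) (dPhi s))
      (is_derive_funN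
      (is_derive_funM (is_derive_fun_id _) (is_derive_fun_cst _ _))))).
    by rewrite /hazard; ring.
  - by move=> s /andP[_ s0]; rewrite subr_ge0 ltW// hazard_lt//; lra.
  - by move=> s /andP[s0 _]; rewrite subr_le0 ltW// hazard_lt//; lra.
rewrite /f addr0 mul0r subr0 lerBlDr => h.
rewrite -[leLHS]lnK ?posrE ?Phi_gt0// -[X in X * _]lnK ?posrE ?Phi_gt0//.
by rewrite -expRD ler_expR.
Qed.

Section key.
Context (R : realType) (t : R) (t0 : 0 < t).
Let S (x : R) : R := sinh (t * x).
Let C (x : R) : R := cosh (t * x).
Let E (x : R) : R := (1 + t ^+ 2) * S x - t * x * C x.
Let k (x : R) : R := phi t * expR (- x ^+ 2 / 2).
Let A (x : R) : R := Phi (x - t) - Phi (- x - t).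

Let dS (x : R) : is_derive x 1 S (t * C x).
Proof.
apply: (is_derive_congr (fun=> erefl) _ (is_derive_fun_comp (is_derive_sinh _)
  (is_derive_funM (is_derive_fun_cst t _) (is_derive_fun_id x)))).
by rewrite /C; ring.
Qed.

Let dC (x : R) : is_derive x 1 C (t * S x).
Proof.
apply: (is_derive_congr (fun=> erefl) _ (is_derive_fun_comp (is_derive_cosh _)
  (is_derive_funM (is_derive_fun_cst t _) (is_derive_fun_id x)))).
by rewrite /S; ring.
Qed.

Let dk (x : R) : is_derive x 1 k (- x * k x).
Proof. by rewrite /k; derive_tac; rewrite /=; field. Qed.

Let phi_sub (x : R) : phi (x - t) = k x * expR (t * x).
Proof.
rewrite /k !phiE -!mulrA -!expRD; congr (_ * expR _); by field.
Qed.

Let phi_add (x : R) : phi (x + t) = k x * expR (- (t * x)).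
Proof.
rewrite /k !phiE -!mulrA -!expRD; congr (_ * expR _); by field.
Qed.

Let dA (x : R) : is_derive x 1 A (2 * k x * C x).
Proof.
have d1 : is_derive x 1 (fun y => y - t) 1.
  by derive_tac; rewrite /=; ring.
have d2 : is_derive x 1 (fun y => - y - t) (- 1).
  by derive_tac; rewrite /=; ring.
apply: (is_derive_congr (fun=> erefl) _ (is_derive_funD
 (is_derive_fun_comp (g := fun y => y - t) (is_derive_Phi _) d1)
 (is_derive_funN (is_derive_fun_comp (g := fun y => - y - t)
   (is_derive_Phi _) d2)))).
by rewrite -opprD phiN phi_sub phi_add /C /cosh; field.
Qed.

Let E_gt0 (x y : R) : 0 < y -> y < x -> 0 < E x -> 0 < E y.
Proof.
move=> y0 yx Ex; have x0 := lt_trans y0 yx.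
have Cn0 (z : R) : 0 < C z by rewrite (lt_le_trans ltr01)// cosh_ge1.
pose r (z : R) : R := - (S z / (z * C z)).
have rE (z : R) : 0 < z -> E z = z * C z * ((1 + t ^+ 2) * - r z - t).
  move=> z0; rewrite /E /r; field.
  by rewrite !gt_eqF.
have ryx : r y < r x.
  have dr z : y <= z <= x ->
      is_derive z 1 r ((S z * C z - t * z) / (z * C z) ^+ 2).
    move=> /andP[yz _]; have z0 : 0 < z by exact: lt_le_trans yz.
    have zC : z * C z != 0 by rewrite gt_eqF// mulr_gt0.
    apply: (is_derive_congr (fun=> erefl) _ (is_derive_funN (is_derive_funM
      (dS z) (is_derive_funV (f := fun z => z * C z) zC
      (is_derive_funM (is_derive_fun_id z) (dC z)))))).
    have CS : C z ^+ 2 = 1 + S z ^+ 2 by exact: sqr_cosh.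
    rewrite [LHS](_ : _ = (S z * (C z + z * (t * S z)) - t * z * C z ^+ 2)
      / (z * C z) ^+ 2); last first.
      by field; rewrite !gt_eqF.
    by rewrite CS; congr (_ / _); ring.
  apply: (derive_gt0_lt yx dr) => z /andP[yz _].
  have z0 : 0 < z by exact: lt_trans yz.
  rewrite divr_gt0//; last by rewrite exprn_gt0// mulr_gt0.
  by rewrite subr_gt0 lt_sinh_cosh// mulr_gt0.
have px : 0 < x * C x by rewrite mulr_gt0.
have py : 0 < y * C y by rewrite mulr_gt0.
move: Ex; rewrite (rE x)// (rE y)// (pmulr_rgt0 _ px) (pmulr_rgt0 _ py).
rewrite !subr_gt0 => /lt_le_trans; apply.
by rewrite ler_wpM2l ?addr_ge0 ?sqr_ge0// lerN2 ltW.
Qed.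

Let D (x : R) : R := 2 * t * k x * S x ^+ 2 / E x - A x.

Let D_lt (x y : R) : 0 < x -> x < y -> 0 < E y -> D x < D y.
Proof.
move=> x0 xy Ey.
have dD z : x <= z <= y -> is_derive z 1 D
    (2 * k z * ((t * z * C z - S z) * (S z * C z - t * z)) / E z ^+ 2).
  move=> /andP[xz zy]; have z0 : 0 < z by exact: lt_le_trans xz.
  have Ez : E z != 0.
    rewrite gt_eqF//; move: zy; rewrite le_eqVlt => /predU1P[->//|zy].
    exact: E_gt0 zy Ey.
  have dE : is_derive z 1 E (t ^+ 2 * (t * C z - z * S z)).
    apply: (is_derive_congr (fun=> erefl) _ (is_derive_funD
      (is_derive_funM (is_derive_fun_cst (1 + t ^+ 2) _) (dS z))
      (is_derive_funN (is_derive_funM (is_derive_funM (is_derive_fun_cst t _)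
        (is_derive_fun_id _)) (dC z))))).
    by ring.
  apply: (is_derive_congr (fun=> erefl) _ (is_derive_funD (is_derive_funM
    (is_derive_funM (is_derive_funM (is_derive_fun_cst (2 * t) _) (dk z))
      (is_derive_funX 2 (dS z))) (is_derive_funV (f := E) Ez dE))
    (is_derive_funN (dA z)))).
  have CS : C z ^+ 2 = 1 + S z ^+ 2 by exact: sqr_cosh.
  rewrite /=; move: CS Ez; rewrite /E.
  move: (S z) (C z) (k z) => s c kz CS Ez.
  transitivity (2 * kz * ((t * z * c - s) * (s * c - t * z)) /
      ((1 + t ^+ 2) * s - t * z * c) ^+ 2 +
    2 * kz * (c ^+ 2 - (1 + s ^+ 2)) * (t * z * s - t ^+ 2 * z ^+ 2 * c) /
      ((1 + t ^+ 2) * s - t * z * c) ^+ 2).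
    by field.
  by rewrite CS subrr mulr0 !mul0r addr0.
apply: (derive_gt0_lt xy dD) => z /andP[xz zy].
have z0 : 0 < z by exact: lt_trans xz.
have tz : 0 < t * z by rewrite mulr_gt0.
have k0 : 0 < k z by rewrite mulr_gt0 ?phi_gt0 ?expR_gt0.
rewrite divr_gt0//; last by rewrite exprn_gt0// (E_gt0 z0 zy).
apply: mulr_gt0; first by rewrite mulr_gt0.
by apply: mulr_gt0; rewrite subr_gt0; [exact: tanh_lt|exact: lt_sinh_cosh].
Qed.

(* Equivalent to the strict monotonicity in [t] of [(p - q) / (t * mass)]. As a
   function of [delta] at fixed [t], the mass and the bound that results from
   dividing by the second factor (when it is positive) both start at 0, and
   the bound has the larger derivative because
   tanh (t delta) < t delta < sinh (t delta) cosh (t delta). *)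
Lemma symmetric_mass_lt (delta : R) : 0 < delta ->
  let p := phi (delta - t) in let q := phi (delta + t) in
  (Phi (delta - t) - Phi (- delta - t)) *
    ((1 + t ^+ 2) * (p - q) - t * delta * (p + q)) < t * (p - q) ^+ 2.
Proof.
move=> d0 /=; rewrite phi_sub phi_add -/(A delta).
have S0 : 0 < S delta by rewrite sinh_gt0// mulr_gt0.
have k0 (x : R) : 0 < k x by rewrite mulr_gt0 ?phi_gt0 ?expR_gt0.
have e : k delta * expR (t * delta) - k delta * expR (- (t * delta)) =
  2 * k delta * S delta by rewrite /S /sinh; field.
have e' : k delta * expR (t * delta) + k delta * expR (- (t * delta)) =
  2 * k delta * C delta by rewrite /C /cosh; field.
rewrite e e'.
have -> : A delta * ((1 + t ^+ 2) * (2 * k delta * S delta) -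
    t * delta * (2 * k delta * C delta)) =
    2 * k delta * (A delta * E delta) by rewrite /E; ring.
have -> : t * (2 * k delta * S delta) ^+ 2 =
    2 * k delta * (2 * t * k delta * S delta ^+ 2) by ring.
rewrite ltr_pM2l; last by rewrite mulr_gt0.
have rhs0 : 0 < 2 * t * k delta * S delta ^+ 2.
  by rewrite mulr_gt0 ?exprn_gt0// mulr_gt0// mulr_gt0.
have A0 (x : R) : 0 < x -> 0 < A x.
  by move=> x0; rewrite subr_gt0; apply: Phi_lt; lra.
have [E0|E0] := leP (E delta) 0.
  by rewrite (le_lt_trans _ rhs0)// mulr_ge0_le0// ltW// A0.
rewrite -ltr_pdivlMr// -subr_gt0 -/(D delta).
have h0 : 0 < delta / 2 by rewrite divr_gt0.
have hd : delta / 2 < delta by lra.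
apply: (@le_lt_trans _ _ (D (delta / 2))); last exact: D_lt.
rewrite leNgt; apply/negP => D0; pose e0 := - D (delta / 2).
have e00 : 0 < e0 by rewrite oppr_gt0.
have [r r0 Hr] := is_derive_dist_lt e00 (dA 0).
pose x := Num.min (r / 2) (delta / 4).
have x0 : 0 < x by rewrite lt_min !divr_gt0.
have xr : x < r by rewrite gt_min; apply/orP; left; lra.
have xd : x < delta / 2 by rewrite gt_min; apply/orP; right; lra.
have Eh : 0 < E (delta / 2) by exact: E_gt0 hd E0.
have := D_lt x0 xd Eh; have Ex := E_gt0 x0 xd Eh.
have : A x < e0.
  have := Hr x; rewrite gtr0_norm// => /(_ xr).
  by rewrite add0r {2}/A oppr0 subrr subr0; apply: le_lt_trans; exact: ler_norm.
have : 0 < 2 * t * k x * S x ^+ 2 / E x.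
  have Sx : 0 < S x by rewrite sinh_gt0// mulr_gt0.
  by rewrite divr_gt0// mulr_gt0 ?exprn_gt0// mulr_gt0// mulr_gt0.
by rewrite /e0 [in D x]/D; lra.
Qed.

End key.

(* For the interval with midpoint [c] and half-length [delta], the mass that the
   normal density with mean [t] puts on it is [window (t - c)]; its logarithmic
   derivative is [- window_slope]. *)
Section symmetric_window.
Context (R : realType) (delta : R) (delta0 : 0 < delta).

Definition window (t : R) : R := Phi (delta - t) - Phi (- delta - t).
Definition window_num (t : R) : R := phi (delta - t) - phi (delta + t).
Definition window_num' (t : R) : R :=
  (delta - t) * phi (delta - t) + (delta + t) * phi (delta + t).
Definition window_slope (t : R) : R := window_num t / window t.
Definition window_slope' (t : R) : R :=
  window_num' t / window t + window_slope t ^+ 2.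
Definition window_ratio (t : R) : R :=
  if t == 0 then window_slope' 0 else window_slope t / t.

Lemma window_gt0 (t : R) : 0 < window t.
Proof. by rewrite subr_gt0; apply: Phi_lt; rewrite ltrD2r gtrN. Qed.

Lemma windowN (t : R) : window (- t) = window t.
Proof.
rewrite /window !opprK (_ : delta + t = - (- delta - t)); last by ring.
by rewrite (_ : - delta + t = - (delta - t)) ?PhiN; ring.
Qed.

Lemma window_numN (t : R) : window_num (- t) = - window_num t.
Proof. by rewrite /window_num opprK opprB. Qed.

Lemma window_num'N (t : R) : window_num' (- t) = window_num' t.
Proof. by rewrite /window_num' opprK addrC. Qed.

Lemma window_slopeN (t : R) : window_slope (- t) = - window_slope t.
Proof. by rewrite /window_slope windowN window_numN mulNr. Qed.

Lemma window_slope0 : window_slope 0 = 0.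
Proof. by rewrite /window_slope /window_num subr0 addr0 subrr mul0r. Qed.

Lemma window_slope'N (t : R) : window_slope' (- t) = window_slope' t.
Proof.
by rewrite /window_slope' windowN window_num'N window_slopeN sqrrN.
Qed.

Lemma window_ratioN (t : R) : window_ratio (- t) = window_ratio t.
Proof.
rewrite /window_ratio oppr_eq0 window_slopeN invrN mulrNN.
by case: eqP => // ->.
Qed.

Lemma is_derive_window (t : R) : is_derive t 1 window (- window_num t).
Proof.
have d1 : is_derive t 1 (fun y => delta - y) (- 1).
  by derive_tac; rewrite /=; ring.
have d2 : is_derive t 1 (fun y => - delta - y) (- 1).
  by derive_tac; rewrite /=; ring.
apply: (is_derive_congr (fun=> erefl) _ (is_derive_funD
  (is_derive_fun_comp (g := fun y => delta - y) (is_derive_Phi _) d1)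
  (is_derive_funN (is_derive_fun_comp (g := fun y => - delta - y)
  (is_derive_Phi _) d2)))).
by rewrite -opprD phiN /window_num; ring.
Qed.

Lemma is_derive_window_num (t : R) : is_derive t 1 window_num (window_num' t).
Proof.
have d1 : is_derive t 1 (fun y => delta - y) (- 1).
  by derive_tac; rewrite /=; ring.
have d2 : is_derive t 1 (fun y => delta + y) 1.
  by derive_tac; rewrite /=; ring.
apply: (is_derive_congr (fun=> erefl) _ (is_derive_funD
  (is_derive_fun_comp (g := fun y => delta - y) (is_derive_phi _) d1)
  (is_derive_funN (is_derive_fun_comp (g := fun y => delta + y)
  (is_derive_phi _) d2)))).
by rewrite /window_num'; ring.
Qed.

Lemma is_derive_window_slope (t : R) :
  is_derive t 1 window_slope (window_slope' t).
Proof.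
have w0 : window t != 0 by rewrite gt_eqF// window_gt0.
apply: (is_derive_congr (fun=> erefl) _ (is_derive_funM
  (is_derive_window_num t)
  (is_derive_funV (f := window) w0 (is_derive_window t)))).
rewrite /window_slope' /window_slope /=; move: w0; move: (window t) => w w0.
by field.
Qed.

Lemma window_slope_lt (t : R) : 0 < t -> window_slope t < t * window_slope' t.
Proof.
move=> t0; have := symmetric_mass_lt t0 delta0; rewrite /= -/(window t).
have w0 := window_gt0 t; have w0' : window t != 0 by rewrite gt_eqF.
rewrite /window_slope' /window_slope /window_num' /window_num.
move: (phi (delta - t)) (phi (delta + t)) (window t) w0 w0' => p q w w0 w0' h.
rewrite -(ltr_pM2r (exprn_gt0 2 w0)).
rewrite [ltLHS](_ : _ = w * (p - q)); last by field.
rewrite [ltRHS](_ : _ = w * (t * ((delta - t) * p + (delta + t) * q)) +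
  t * (p - q) ^+ 2); last by field.
lra.
Qed.

Lemma window_ratio_lt (s t : R) : 0 < s -> s < t ->
  window_ratio s < window_ratio t.
Proof.
move=> s0 st; have t0 := lt_trans s0 st.
rewrite /window_ratio !gt_eqF//.
have dr z : s <= z <= t -> is_derive z 1 (fun t => window_slope t / t)
    ((z * window_slope' z - window_slope z) / z ^+ 2).
  move=> /andP[sz _]; have z0 : z != 0 by rewrite gt_eqF// (lt_le_trans s0).
  apply: (is_derive_congr (fun=> erefl) _ (is_derive_funM
    (is_derive_window_slope z)
    (is_derive_funV (f := fun x => x) z0 (is_derive_fun_id z)))).
  by field.
apply: (derive_gt0_lt st dr) => z /andP[sz _].
have z0 := lt_trans s0 sz.
by rewrite divr_gt0 ?exprn_gt0// subr_gt0 window_slope_lt.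
Qed.

Lemma window_ratio0_le (t : R) : 0 < t -> window_ratio 0 <= window_ratio t.
Proof.
move=> t0; rewrite /window_ratio eqxx -/(window_ratio t).
apply/ler_addgt0Pl => e e0.
have [r r0 Hr] := is_derive_eps e0 (is_derive_window_slope 0).
pose h := Num.min (r / 2) (t / 2).
have h0 : 0 < h by rewrite lt_min !divr_gt0.
have hr : h < r by rewrite gt_min; apply/orP; left; lra.
have ht : h < t by rewrite gt_min; apply/orP; right; lra.
have := Hr h; rewrite gtr0_norm// => /(_ hr).
rewrite window_slope0 add0r subr0 ler_norml => /andP[hl _].
apply: (@le_trans _ _ (e + window_ratio h)).
  rewrite /window_ratio gt_eqF//= -(ler_pM2r h0) [leRHS]mulrDl divfK ?gt_eqF//.
  lra.
by rewrite lerD2l ltW// window_ratio_lt.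
Qed.

Lemma window_ratio_slope (t : R) : window_ratio t * t = window_slope t.
Proof.
rewrite /window_ratio; case: eqP => [->|/eqP t0]; last by rewrite mulfVK.
by rewrite mulr0 window_slope0.
Qed.

Lemma window_ratio_slope'_lt (t : R) : t != 0 ->
  window_ratio t < window_slope' t.
Proof.
wlog t0 : t / 0 < t => [h tn0|_].
  have [t0|t0|t0] := ltgtP 0 t; first exact: h.
    by rewrite -window_ratioN -window_slope'N h ?oppr_gt0// oppr_eq0.
  by rewrite -t0 eqxx in tn0.
rewrite /window_ratio gt_eqF// ltr_pdivrMr// mulrC.
exact: window_slope_lt.
Qed.

Lemma window_ub (c x : R) :
  window x <= window c * expR (window_ratio c * (c ^+ 2 - x ^+ 2) / 2).
Proof.
wlog c0 : c / 0 <= c => [h|].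
  have [/h//|/ltW c0] := leP 0 c.
  by have := h (- c); rewrite windowN window_ratioN sqrrN oppr_ge0; apply.
wlog x0 : x / 0 <= x => [h|].
  have [/h//|/ltW x0] := leP 0 x.
  by have := h (- x); rewrite windowN sqrrN oppr_ge0; apply.
set k := window_ratio c.
pose F (y : R) : R := ln (window y) + k * y ^+ 2 / 2.
have dF (y : R) : is_derive y 1 F (y * (k - window_ratio y)).
  have d2 : is_derive y 1 (fun y => k * y ^+ 2 / 2) (k * y).
    by derive_tac; rewrite /=; field.
  apply: (is_derive_congr (fun=> erefl) _ (is_derive_funD (is_derive_fun_ln
    (f := window) (window_gt0 y) (is_derive_window y)) d2)).
  rewrite mulrBr [y * window_ratio y]mulrC window_ratio_slope /window_slope.
  by ring.
have : F x <= F c.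
  apply: (derive_sign_max dF) => y /andP[y1 y2].
    have y0 := le_lt_trans x0 y1.
    by apply: mulr_ge0; [exact: ltW|rewrite subr_ge0 ltW// window_ratio_lt].
  have y0 := le_lt_trans c0 y1.
  apply: mulr_ge0_le0; [exact: ltW|rewrite subr_le0].
  move: c0; rewrite /k le_eqVlt => /predU1P[<-|c0].
    exact: window_ratio0_le.
  by rewrite ltW// window_ratio_lt.
rewrite /F => h.
rewrite -[leLHS]lnK ?posrE ?window_gt0//.
rewrite -[X in X * _]lnK ?posrE ?window_gt0// -expRD ler_expR; lra.
Qed.

End symmetric_window.

Definition shifted_cdf (R : realType) (e : \bar R) (t : R) : R :=
  match e with r%:E => Phi (r - t) | +oo%E => 1 | -oo%E => 0 end.

Definition shifted_pdf (R : realType) (e : \bar R) (t : R) : R :=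
  if e is r%:E then phi (r - t) else 0.

Definition shifted_pdf' (R : realType) (e : \bar R) (t : R) : R :=
  if e is r%:E then (r - t) * phi (r - t) else 0.

Lemma is_derive_shifted_cdf (R : realType) (e : \bar R) (t : R) :
  is_derive t 1 (shifted_cdf e) (- shifted_pdf e t).
Proof.
case: e => [r||]; rewrite /shifted_cdf /shifted_pdf ?oppr0.
- have d : is_derive t 1 (fun y => r - y) (- 1).
    by derive_tac; rewrite /=; ring.
  apply: (is_derive_congr (fun=> erefl) _
    (is_derive_fun_comp (g := fun y => r - y) (is_derive_Phi _) d)).
  by ring.
- exact: is_derive_fun_cst.
- exact: is_derive_fun_cst.
Qed.

Lemma is_derive_shifted_pdf (R : realType) (e : \bar R) (t : R) :
  is_derive t 1 (shifted_pdf e) (shifted_pdf' e t).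
Proof.
case: e => [r||]; rewrite /shifted_pdf /shifted_pdf'.
- have d : is_derive t 1 (fun y => r - y) (- 1).
    by derive_tac; rewrite /=; ring.
  apply: (is_derive_congr (fun=> erefl) _
    (is_derive_fun_comp (g := fun y => r - y) (is_derive_phi _) d)).
  by ring.
- exact: is_derive_fun_cst.
- exact: is_derive_fun_cst.
Qed.

Section standard_truncation.
Context (R : realType) (a b : \bar R) (ab : (a < b)%E).

Definition trunc_mass (t : R) : R := shifted_cdf b t - shifted_cdf a t.
Definition trunc_mass' (t : R) : R := shifted_pdf a t - shifted_pdf b t.
Definition trunc_mass'' (t : R) : R := shifted_pdf' a t - shifted_pdf' b t.
Definition trunc_mean : R := trunc_mass' 0 / trunc_mass 0.
Definition trunc_var : R :=
  1 + trunc_mass'' 0 / trunc_mass 0 - trunc_mean ^+ 2.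
Definition trunc_mgf (t : R) : R :=
  expR (t ^+ 2 / 2 - t * trunc_mean) * (trunc_mass t / trunc_mass 0).
Definition trunc_mgf' (t : R) : R := expR (t ^+ 2 / 2 - t * trunc_mean) *
  (((t - trunc_mean) * trunc_mass t + trunc_mass' t) / trunc_mass 0).
Definition trunc_proxy : R :=
  match a, b with
  | r%:E, s%:E => 1 - window_ratio ((s - r) / 2) ((r + s) / 2)
  | _, _ => 1
  end.

Lemma trunc_mass_gt0 (t : R) : 0 < trunc_mass t.
Proof.
rewrite subr_gt0; case: a b ab => [r||] [s||]//=;
  rewrite ?lte_fin ?Phi_lt1 ?Phi_gt0//.
by move=> rs; apply: Phi_lt; rewrite ltrD2r.
Qed.

Let dexp (t : R) : is_derive t 1 (fun t => expR (t ^+ 2 / 2 - t * trunc_mean))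
  (expR (t ^+ 2 / 2 - t * trunc_mean) * (t - trunc_mean)).
Proof. by derive_tac; rewrite /=; field. Qed.

Let dmass (t : R) : is_derive t 1 trunc_mass (trunc_mass' t).
Proof.
apply: (is_derive_congr (fun=> erefl) _ (is_derive_funD
  (is_derive_shifted_cdf b t) (is_derive_funN (is_derive_shifted_cdf a t)))).
by rewrite /trunc_mass' opprK addrC.
Qed.

Let dmass' (t : R) : is_derive t 1 trunc_mass' (trunc_mass'' t).
Proof.
exact: is_derive_funD (is_derive_shifted_pdf a t)
  (is_derive_funN (is_derive_shifted_pdf b t)).
Qed.

Lemma is_derive_trunc_mgf (t : R) : is_derive t 1 trunc_mgf (trunc_mgf' t).
Proof.
apply: (is_derive_congr (fun=> erefl) _ (is_derive_funM (dexp t)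
  (is_derive_funM (dmass t) (is_derive_fun_cst (trunc_mass 0)^-1 t)))).
by rewrite /trunc_mgf'; ring.
Qed.

Lemma is_derive_trunc_mgf' : is_derive (0 : R) 1 trunc_mgf' trunc_var.
Proof.
have dl : is_derive (0 : R) 1 (fun t => t - trunc_mean) 1.
  by derive_tac; rewrite /=; ring.
apply: (is_derive_congr (fun=> erefl) _ (is_derive_funM (dexp 0)
  (is_derive_funM (is_derive_funD (is_derive_funM dl (dmass 0)) (dmass' 0))
  (is_derive_fun_cst (trunc_mass 0)^-1 0)))).
rewrite expr0n/= mul0r mul0r subr0 expR0 /trunc_var /trunc_mean.
by field; rewrite gt_eqF// trunc_mass_gt0.
Qed.

Lemma trunc_mgf_leP (t v : R) : (trunc_mgf t <= expR (v * t ^+ 2 / 2)) =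
  (trunc_mass t <=
    trunc_mass 0 * expR (t * trunc_mean - (1 - v) * t ^+ 2 / 2)).
Proof.
rewrite /trunc_mgf mulrC -ler_pdivlMr ?expR_gt0// -expRN -expRD.
rewrite ler_pdivrMr ?trunc_mass_gt0// mulrC.
by congr (_ <= _ * expR _); field.
Qed.

End standard_truncation.

Section finite_truncation.
Context (R : realType) (r s : R) (rs : r < s).
Let c : R := (r + s) / 2.
Let d : R := (s - r) / 2.

Let d0 : 0 < d. Proof. by rewrite divr_gt0// subr_gt0. Qed.

Let rE : r = c - d. Proof. by rewrite /c /d; field. Qed.

Let sE : s = c + d. Proof. by rewrite /c /d; field. Qed.

Lemma trunc_mass_window (t : R) : trunc_mass r%:E s%:E t = window d (t - c).
Proof.
by rewrite /trunc_mass /window/= {1}sE {1}rE; congr (Phi _ - Phi _); ring.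
Qed.

Lemma trunc_mass0_window : trunc_mass r%:E s%:E 0 = window d c.
Proof. by rewrite trunc_mass_window sub0r windowN. Qed.

Let phir : phi r = phi (d - c).
Proof. by rewrite -phiN {1}rE; congr phi; ring. Qed.

Let phis : phi s = phi (d + c).
Proof. by rewrite {1}sE addrC. Qed.

Lemma trunc_mean_window : trunc_mean r%:E s%:E = window_slope d c.
Proof.
rewrite /trunc_mean trunc_mass0_window /trunc_mass'/= !subr0.
by rewrite phir phis.
Qed.

Lemma trunc_var_window : trunc_var r%:E s%:E = 1 - window_slope' d c.
Proof.
rewrite /trunc_var trunc_mean_window trunc_mass0_window /window_slope'.
rewrite /trunc_mass''/= !subr0 phir phis /window_num' {1}rE {1}sE.
by ring.
Qed.

Lemma trunc_mgf_finite_ub (t : R) :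
  trunc_mgf r%:E s%:E t <= expR (trunc_proxy r%:E s%:E * t ^+ 2 / 2).
Proof.
rewrite trunc_mgf_leP ?lte_fin// trunc_mass0_window trunc_mass_window.
rewrite trunc_mean_window (le_trans (window_ub d0 c _))//.
rewrite ler_pM2l ?window_gt0// ler_expR /trunc_proxy -/c -/d.
rewrite -(window_ratio_slope d c) le_eqVlt; apply/orP; left; apply/eqP.
by field.
Qed.

Lemma trunc_proxy_finite_opt (v : R) : trunc_var r%:E s%:E <= v ->
  (forall t, trunc_mgf r%:E s%:E t <= expR (v * t ^+ 2 / 2)) ->
  trunc_proxy r%:E s%:E <= v.
Proof.
rewrite trunc_var_window /trunc_proxy -/c -/d => vv H.
have [c0|c0] := eqVneq c 0; first by rewrite /window_ratio c0 eqxx -c0.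
have := H (2 * c); rewrite trunc_mgf_leP ?lte_fin//.
rewrite trunc_mass0_window trunc_mass_window trunc_mean_window.
rewrite (_ : 2 * c - c = c); last by ring.
rewrite ler_pMr ?window_gt0// -[leLHS]expR0 ler_expR.
rewrite -window_ratio_slope => h.
have c2 : 0 < c ^+ 2 by rewrite exprn_even_gt0.
rewrite -(ler_pM2r c2); move: (c) (window_ratio d c) c2 h => x w x2.
by rewrite exprMn; lra.
Qed.

Lemma trunc_var_finite_lt : r + s != 0 ->
  trunc_var r%:E s%:E < trunc_proxy r%:E s%:E.
Proof.
move=> rs0; rewrite trunc_var_window /trunc_proxy -/c -/d ltrD2l ltrN2.
by rewrite window_ratio_slope'_lt// mulf_neq0// invr_eq0.
Qed.

Lemma trunc_var_finite_sym : r + s = 0 ->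
  trunc_var r%:E s%:E = trunc_proxy r%:E s%:E.
Proof.
move=> rs0; rewrite trunc_var_window /trunc_proxy -/c -/d.
by rewrite (_ : c = 0) /window_ratio ?eqxx// /c rs0 mul0r.
Qed.

End finite_truncation.

Lemma trunc_mgf_ub (R : realType) (a b : \bar R) (t : R) : (a < b)%E ->
  trunc_mgf a b t <= expR (trunc_proxy a b * t ^+ 2 / 2).
Proof.
case: a b => [r||] [s||]//= ab; rewrite ?trunc_mgf_leP//.
- by rewrite -trunc_mgf_leP//; exact: trunc_mgf_finite_ub.
- rewrite /trunc_mean /trunc_mass /trunc_mass'/= !subr0 -!PhiN subrr !mul0r.
  rewrite subr0 opprB addrC -phiN; exact: Phi_log_concave.
- rewrite /trunc_mean /trunc_mass /trunc_mass'/= !subr0 subrr !mul0r subr0.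
  by rewrite sub0r mulNr mulrN -mulNr; exact: Phi_log_concave.
- rewrite /trunc_mean /trunc_mass /trunc_mass'/= !subr0 subrr !mul0r mulr0.
  by rewrite subr0 expR0 mulr1.
Qed.

Lemma trunc_proxy_opt (R : realType) (a b : \bar R) (v : R) : (a < b)%E ->
  trunc_var a b <= v -> (forall t, trunc_mgf a b t <= expR (v * t ^+ 2 / 2)) ->
  trunc_proxy a b <= v.
Proof.
move=> ab vv H.
(* On a half-line the mass grows towards the infinite end, so in that direction
   only the linear term competes with the quadratic one. *)
have far (e : R) : e ^+ 2 = 1 ->
    (forall t, 0 < t -> trunc_mass a b 0 <= trunc_mass a b (e * t)) -> 1 <= v.
  move=> e1 mono; rewrite leNgt; apply/negP => v1.
  have v1' : 0 < 1 - v by rewrite subr_gt0.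
  pose m := trunc_mean a b; pose t := (2 * `|m| + 1) / (1 - v).
  have t0 : 0 < t by rewrite divr_gt0// ltr_wpDl// mulr_ge0.
  have := H (e * t); rewrite trunc_mgf_leP// => /(le_trans (mono _ t0)).
  rewrite ler_pMr ?trunc_mass_gt0// -[leLHS]expR0 ler_expR exprMn e1 mul1r -/m.
  have tE : (1 - v) * t = 2 * `|m| + 1 by rewrite /t mulrC divfK// gt_eqF.
  rewrite [X in _ - X](_ : _ = t * ((1 - v) * t / 2)); last by ring.
  rewrite tE [e * t]mulrC -mulrA -mulrBr pmulr_rge0//.
  have : e * m <= `|m|.
    have en : `|e| = 1.
      by apply/eqP; rewrite -(@eqrXn2 _ 2)// real_normK ?num_real// e1 expr1n.
    by rewrite (le_trans (ler_norm _))// normrM en mul1r.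
  lra.
case: a b ab vv H far => [r||] [s||]//= ab vv H far.
- exact: trunc_proxy_finite_opt.
- apply: (far 1) => [|t t0]; first by rewrite expr1n.
  by rewrite /trunc_mass/= mul1r lerD2l lerN2 ltW// Phi_lt//; lra.
- apply: (far (- 1)) => [|t t0]; first by rewrite sqrrN expr1n.
  by rewrite /trunc_mass/= lerD2r ltW// Phi_lt//; lra.
- by apply: (far 1) => //; rewrite expr1n.
Qed.

Lemma trunc_var_eqP (R : realType) (a b : \bar R) : (a < b)%E ->
  trunc_var a b = trunc_proxy a b <->
  (exists r s : R, [/\ a = r%:E, b = s%:E & r + s = 0]) \/
  (a = -oo%E /\ b = +oo%E).
Proof.
move=> ab; split; last first.
  move=> [[r [s [aE bE rs]]]|[-> ->]].
    by rewrite aE bE; apply: trunc_var_finite_sym.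
  rewrite /trunc_var /trunc_mean /trunc_mass' /trunc_mass''/=.
  by rewrite !subrr !mul0r expr0n/= subr0 addr0.
case: a b ab => [r||] [s||]//= ab varE.
- left; exists r, s; split => //; apply/eqP; apply: contraT => rs.
  by have := trunc_var_finite_lt ab rs; rewrite varE ltxx.
- move: varE; rewrite /trunc_var /trunc_mean /trunc_mass /trunc_mass'/=.
  rewrite /trunc_mass''/= !subr0 -PhiN => varE.
  have := Mills_inequality (- r); rewrite phiN.
  have := Phi_gt0 (- r); have := phi_gt0 r.
  move: (phi r) (Phi (- r)) varE => p w varE p0 w0 h.
  have pw : 0 < p * (- r * w + p) by rewrite mulr_gt0.
  suff pw0 : p * (- r * w + p) = 0 by rewrite pw0 ltxx in pw.
  have w0' : w != 0 by rewrite gt_eqF.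
  have := congr1 (fun x => w ^+ 2 * (1 - x)) varE.
  by rewrite subrr mulr0 => <-; field.
- move: varE; rewrite /trunc_var /trunc_mean /trunc_mass /trunc_mass'/=.
  rewrite /trunc_mass''/= !subr0 => varE.
  have := Mills_inequality s; have := Phi_gt0 s; have := phi_gt0 s.
  move: (phi s) (Phi s) varE => p w varE p0 w0 h.
  have pw : 0 < p * (s * w + p) by rewrite mulr_gt0.
  suff pw0 : p * (s * w + p) = 0 by rewrite pw0 ltxx in pw.
  have w0' : w != 0 by rewrite gt_eqF.
  have := congr1 (fun x => w ^+ 2 * (1 - x)) varE.
  by rewrite subrr mulr0 => <-; field.
- by right.
Qed.

Definition standardize (R : realType) (mu sigma : R) (e : \bar R) : \bar R :=
  match e with
  | r%:E => ((r - mu) / sigma)%:E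
  | +oo%E => +oo%E
  | -oo%E => -oo%E
  end.

Lemma standardize_lt (R : realType) (mu sigma : R) (a b : \bar R) :
  0 < sigma -> (a < b)%E ->
  (standardize mu sigma a < standardize mu sigma b)%E.
Proof.
move=> s0; case: a b => [r||] [s||]//=; rewrite ?ltry ?ltNyr// !lte_fin => rs.
by rewrite ltr_pM2r ?invr_gt0// ltrD2r.
Qed.

Lemma extended_normal_cdf_shift (R : realType) (mu sigma t : R) (e : \bar R) :
  0 < sigma -> extended_normal_cdf (mu + sigma * t) sigma e =
  shifted_cdf (standardize mu sigma e) t.
Proof.
move=> s0; case: e => [r||]//=; congr Phi.
by field; rewrite gt_eqF.
Qed.

Section truncated_normal.
Context (R : realType) (mu sigma : R) (a b : \bar R)
  (d d' : measure_display) (T : measurableType d) (T' : measurableType d')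
  (P : probability T R) (X : {RV P >-> R})
  (Q : probability T' R) (XT : {RV Q >-> R}).
Context (sigma_gt0 : 0 < sigma) (lt_ab : (a < b)%E)
  (normalX : normal_rv X mu sigma) (truncX : truncation X XT a b).

Let al := standardize mu sigma a.
Let be := standardize mu sigma b.
Let lt_albe : (al < be)%E. Proof. exact: standardize_lt. Qed.
Let m : R := mu + sigma * trunc_mean al be.
Let W (w : T') : R := sigma^-1 * (XT w - m).

Let XTE (w : T') : XT w = m + sigma * W w.
Proof. by rewrite /W mulVKf ?gt_eqF//; ring. Qed.

Let mgfW : has_mgf Q W (trunc_mgf al be).
Proof.
have mgfXT := conj (measurable_funPT XT) (fun theta =>
  expectation_expR_truncation theta sigma_gt0 lt_ab normalX truncX).
have := has_mgf_affine m sigma^-1 mgfXT; congr has_mgf; apply/funext => t.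
have s0 : sigma != 0 by rewrite gt_eqF.
have -> : mu + sigma ^+ 2 * (sigma^-1 * t) = mu + sigma * t by field.
rewrite mulrA -expRD !extended_normal_cdf_shift//.
have cdf0 (e : \bar R) : extended_normal_cdf mu sigma e =
    shifted_cdf (standardize mu sigma e) 0.
  by rewrite -extended_normal_cdf_shift// mulr0 addr0.
rewrite !cdf0 /trunc_mgf -/al -/be; congr (expR _ * _).
by rewrite /m; field.
Qed.

Let integrableW : Q.-integrable [set: T'] (EFin \o W).
Proof. exact: integrable_id mgfW. Qed.

Let meanW : \int[Q]_w W w = 0.
Proof.
have dM (t : R) := is_derive_trunc_mgf al be t.
apply: (mgf_mean mgfW); first by move=> t; have [] := dM t.
have := dM 0; apply: is_derive_congr => //.
rewrite /trunc_mgf' sub0r /trunc_mean mulNr divfK ?addNr ?mul0r ?mulr0//.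
by rewrite gt_eqF// trunc_mass_gt0.
Qed.

Let varW : \int[Q]_w W w ^+ 2 = trunc_var al be.
Proof.
exact: (mgf_second_moment mgfW (is_derive_trunc_mgf al be)
  (is_derive_trunc_mgf' lt_albe)).
Qed.

Lemma truncated_integrable : Q.-integrable [set: T'] (EFin \o XT).
Proof.
have ic : Q.-integrable [set: T'] (EFin \o (fun=> m)).
  exact: finite_measure_integrable_cst.
have := integrableD measurableT ic (integrableZl measurableT sigma integrableW).
by apply: eq_integrable => // w _ /=; rewrite XTE.
Qed.

Lemma truncated_mean : fine 'E_Q[XT] = m.
Proof.
rewrite unlock -[LHS]/(\int[Q]_w XT w).
under eq_Rintegral do rewrite XTE.
rewrite RintegralD//; last 2 first.
- exact: finite_measure_integrable_cst.
- exact: (integrableZl measurableT sigma integrableW).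
by rewrite Rintegral_probability_cst RintegralZl// meanW mulr0 addr0.
Qed.

Lemma truncated_centered (w : T') : XT w - fine 'E_Q[XT] = sigma * W w.
Proof. by rewrite truncated_mean XTE addrC addKr. Qed.

Lemma truncated_mgf (theta : R) :
  ('E_Q[fun w => expR (theta * (XT w - fine 'E_Q[XT]))] =
   (trunc_mgf al be (sigma * theta))%:E)%E.
Proof.
rewrite -(mgfW.2); congr ('E_Q[_])%E; apply/funext => w.
by rewrite truncated_centered; congr expR; ring.
Qed.

Lemma truncated_variance : ('V_Q[XT] = (sigma ^+ 2 * trunc_var al be)%:E)%E.
Proof.
have is2 := integrable_sqr mgfW.
rewrite /variance covariance.unlock.
transitivity ('E_Q[fun w => sigma ^+ 2 * W w ^+ 2]%R)%E.
  congr ('E_Q[_])%E; apply/funext => w /=.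
  by rewrite !fctE /= truncated_centered; ring.
rewrite -varW -RintegralZl// unlock /Rintegral fineK//.
apply: integrable_fin_num => //.
exact: (integrableZl measurableT _ is2).
Qed.

Lemma truncated_proxy_ge0 : 0 <= trunc_proxy al be.
Proof.
apply: (@le_trans _ _ (\int[Q]_w W w ^+ 2)).
  by apply: Rintegral_ge0 => w _; exact: sqr_ge0.
apply: (mgf_variance_proxy_ge mgfW) => t; exact: trunc_mgf_ub.
Qed.

Lemma truncated_optimal :
  optimal_variance_proxy XT (sigma ^+ 2 * trunc_proxy al be).
Proof.
split.
  split; first exact: truncated_integrable.
  have v0 : 0 <= sigma ^+ 2 * trunc_proxy al be.
    by rewrite mulr_ge0 ?sqr_ge0 ?truncated_proxy_ge0.
  exists (Num.sqrt (sigma ^+ 2 * trunc_proxy al be)).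
  split; rewrite ?sqrtr_ge0 ?sqr_sqrtr// => theta.
  rewrite truncated_mgf lee_fin (le_trans (trunc_mgf_ub _ lt_albe))//.
  by rewrite exprMn mulrA (mulrC (trunc_proxy _ _)).
move=> w [_ [s [s0 wE H]]].
have s20 : 0 < sigma ^+ 2 by rewrite exprn_gt0.
have Hv (t : R) : trunc_mgf al be t <= expR (w / sigma ^+ 2 * t ^+ 2 / 2).
  have := H (t / sigma); rewrite truncated_mgf lee_fin mulrC divfK ?gt_eqF//.
  move=> /le_trans; apply; rewrite wE le_eqVlt; apply/orP; left; apply/eqP.
  by congr expR; field; rewrite gt_eqF.
rewrite mulrC -ler_pdivlMr//; apply: trunc_proxy_opt => //.
by rewrite -varW; exact: (mgf_variance_proxy_ge mgfW).
Qed.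

Lemma truncated_strict : strictly_sub_gaussian XT <->
  (exists a0 b0 : R, [/\ a = a0%:E, b = b0%:E & a0 + b0 = 2 * mu])
  \/ (a = -oo%E /\ b = +oo%E).
Proof.
have s20 : sigma ^+ 2 != 0 by rewrite expf_neq0// gt_eqF.
have sn0 : sigma != 0 by rewrite gt_eqF.
have strictE : strictly_sub_gaussian XT <-> trunc_var al be = trunc_proxy al be.
  rewrite /strictly_sub_gaussian truncated_variance; split => [[v [v1 v2]]|vE].
    move=> [vE]; apply: (mulfI s20); rewrite vE.
    have [w1 w2] := truncated_optimal.
    by apply/eqP; rewrite eq_le v2// w2.
  exists (sigma ^+ 2 * trunc_var al be); rewrite ?vE//.
  exact: truncated_optimal.
apply: (iff_trans strictE); apply: (iff_trans (trunc_var_eqP lt_albe)).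
split => [[|[]]|[|[]]].
- move=> [r [s []]]; rewrite /al /be.
  case: (a) => [a0||]//=; case: (b) => [b0||]//= [<-] [<-] rs.
  left; exists a0, b0; split => //.
  move/(congr1 (fun x => x * sigma + 2 * mu)): rs; rewrite mul0r add0r => <-.
  by field.
- by rewrite /al /be; case: (a) => [a0||]//; case: (b) => [b0||]// _ _; right.
- move=> [a0 [b0 [aE bE ab]]]; left; rewrite /al /be aE bE.
  exists ((a0 - mu) / sigma), ((b0 - mu) / sigma); split => //.
  rewrite -mulrDl (_ : a0 - mu + (b0 - mu) = 0) ?mul0r//.
  by rewrite addrACA ab; ring.
- by rewrite /al /be => -> ->; right.
Qed.

Lemma truncated_proxyE : trunc_proxy al be =
  match a, b with
  | EFin a0, EFin b0 =>
      if a0 + b0 != 2 * mu then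
        1 - 2 * sigma / (b0 + a0 - 2 * mu) *
            ((phi ((a0 - mu) / sigma) - phi ((b0 - mu) / sigma)) /
             (Phi ((b0 - mu) / sigma) - Phi ((a0 - mu) / sigma)))
      else
        1 - 2 * (b0 - mu) / sigma *
            (phi ((b0 - mu) / sigma) /
             (2 * Phi ((b0 - mu) / sigma) - 1))
  | _, _ => 1
  end.
Proof.
have sn0 : sigma != 0 by rewrite gt_eqF.
have := lt_albe; rewrite /al /be.
case: (a) => [a0||]//=; case: (b) => [b0||]//=; rewrite lte_fin => rs.
have meanE := trunc_mean_window ((a0 - mu) / sigma) ((b0 - mu) / sigma).
rewrite /trunc_mean /trunc_mass /trunc_mass'/= !subr0 in meanE.
case: ifPn => ab.
  have ab' : b0 + a0 - 2 * mu != 0 by rewrite subr_eq0 addrC.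
  rewrite meanE /window_ratio ifF; last first.
    apply/negbTE; rewrite -mulrDl !mulf_neq0 ?invr_eq0//.
    by move: ab'; congr (_ != 0); ring.
  by congr (_ - _); field; rewrite sn0 ab'/=.
rewrite negbK in ab; move/eqP: ab => ab.
set s := (b0 - mu) / sigma.
have aE : (a0 - mu) / sigma = - s.
  by rewrite /s -mulNr; congr (_ / _); lra.
rewrite aE addNr mul0r opprK /window_ratio eqxx.
have -> : (s + s) / 2 = s by field.
rewrite /window_slope' window_slope0 expr0n addr0 /window_num' /window.
rewrite !subr0 !addr0 PhiN; congr (_ - _).
rewrite (_ : Phi s - (1 - Phi s) = 2 * Phi s - 1); last by ring.
by rewrite /s; ring.
Qed.

End truncated_normal.

Unset Implicit Arguments.

Theorem theorem2p1 (R : realType) (mu sigma : R) (a b : \bar R)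
    (d d' : measure_display) (T : measurableType d) (T' : measurableType d')
    (P : probability T R) (X : {RV P >-> R})
    (Q : probability T' R) (XT : {RV Q >-> R})
    (sigma_gt0 : 0 < sigma) (lt_ab : (a < b)%E)
    (normalX : normal_rv X mu sigma)
    (truncX : truncation X XT a b) :
  optimal_variance_proxy XT
    (sigma ^+ 2 *
     match a, b with
     | EFin a0, EFin b0 =>
         if a0 + b0 != 2 * mu then
           1 - 2 * sigma / (b0 + a0 - 2 * mu) *
               ((phi ((a0 - mu) / sigma) - phi ((b0 - mu) / sigma)) /
                (Phi ((b0 - mu) / sigma) - Phi ((a0 - mu) / sigma)))
         else
           1 - 2 * (b0 - mu) / sigma *
               (phi ((b0 - mu) / sigma) /
                (2 * Phi ((b0 - mu) / sigma) - 1))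
     | _, _ => 1
     end)
  /\
  (strictly_sub_gaussian XT <->
    (exists a0 b0 : R, [/\ a = a0%:E, b = b0%:E & a0 + b0 = 2 * mu])
    \/ (a = -oo%E /\ b = +oo%E)).
Proof.
have o := truncated_optimal sigma_gt0 lt_ab normalX truncX.
rewrite truncated_proxyE// in o.
split; first exact: o.
exact: truncated_strict sigma_gt0 lt_ab normalX truncX.
Qed.
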